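(* Let $R$ be a Dedekind domain with fraction field $K$ such that $2\leq |\operatorname{cl}(R)|<\infty$, let $n\geq 1$, and let $\omega$ be a symplectic form on $R^{2n}$, extended to $K^{2n}$. Then the symplectic Steinberg module $\operatorname{St}^\omega_n(K)=\tilde{H}_{n-1}(\operatorname{T}^\omega(K^{2n}))$ is not generated by integral apartment classes.
   Context: $\operatorname{cl}(R)$ is the class group of $R$: the set of isomorphism classes of rank-1 projective $R$-modules, an abelian group under tensor product. A symplectic form on $R^{2n}$ is a non-degenerate bilinear form $\omega$ with $\omega(x,x)=0$ for all $x$; it extends $K$-bilinearly to a symplectic form (also denoted $\omega$) on $K^{2n}=R^{2n}\otimes_R K$. A subspace $V\subseteq K^{2n}$ is isotropic if $\omega(x,y)=0$ for all $x,y\in V$. $\operatorname{T}^\omega(K^{2n})$ is the poset of nonzero isotropic subspaces of $K^{2n}$ ordered by inclusion, identified with its order complex, which is $(n-1)$-dimensional; $\operatorname{St}^\omega_n(K)$ is its reduced homology group in degree $n-1$. Let $[n]=\{1,\dots,n\}$, $[\pm n]=\{1,\dots,n,-n,\dots,-1\}$, and let $S^B_n$ be the group of signed permutations, i.e. permutations $\sigma$ of $[\pm n]$ with $\sigma(-i)=-\sigma(i)$, with multiplication being composition of functions; it is generated by $s_1,\dots,s_n$, where for $i<n$, $s_i$ swaps $i$ with $i+1$ (and $-i$ with $-(i+1)$) and fixes all other elements, and $s_n$ swaps $n$ with $-n$ and fixes all other elements. $\operatorname{len}(\sigma)$ is the word length of $\sigma$ with respect to $\{s_1,\dots,s_n\}$.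 A symplectic frame of $K^{2n}$ is a collection $\mathbf{L}=\{L_1,\dots,L_n,L_{-n},\dots,L_{-1}\}$ of 1-dimensional subspaces such that $L_i+L_j$ is isotropic if and only if $j\neq -i$. For $\sigma\in S^B_n$ and $1\le m\le n$ put $L_{\sigma([m])}=\bigoplus_{i\in\sigma([m])}L_i$ (an isotropic subspace), and let $\mathbf{L}_\sigma$ be the $(n-1)$-simplex $L_{\sigma([1])}\subset\cdots\subset L_{\sigma([n])}$ of $\operatorname{T}^\omega(K^{2n})$. The apartment class of $\mathbf{L}$ is $[\Sigma_{\mathbf{L}}]=\sum_{\sigma\in S^B_n}(-1)^{\operatorname{len}(\sigma)}\mathbf{L}_\sigma\in\operatorname{St}^\omega_n(K)$ (defined up to sign). The frame $\mathbf{L}$, and its apartment class, is called integral if $R^{2n}=(L_1\cap R^{2n})\oplus\cdots\oplus(L_n\cap R^{2n})\oplus(L_{-n}\cap R^{2n})\oplus\cdots\oplus(L_{-1}\cap R^{2n})$. *)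

(* Defs.v *)
From HB Require Import structures.
From mathcomp Require Import all_boot all_order all_fingroup all_algebra.
From mathcomp Require Import ring_quotient generic_quotient.
From mathcomp Require Import freeg.
From mathcomp Require Import zify.
From mathcomp Require Import boolp classical_sets cardinality.

Set Implicit Arguments.
Unset Strict Implicit.
Unset Printing Implicit Defensive.

Import Order.TTheory GRing.Theory.

Local Open Scope ring_scope.

Section Ideals.
Variable R : idomainType.

Definition is_ideal (I : set R) : Prop :=
  [/\ I 0, forall x y, I x -> I y -> I (x + y)
    & forall a x, I x -> I (a * x)].

Definition ideal_fg (I : set R) : Prop :=
  exists (k : nat) (g : 'I_k -> R),
    forall x, I x <-> exists a : 'I_k -> R, x = \sum_i a i * g i.

Definition is_prime_ideal (I : set R) : Prop :=
  [/\ is_ideal I, ~ I 1 & forall x y, I (x * y) -> I x \/ I y].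

Definition is_maximal_ideal (I : set R) : Prop :=
  [/\ is_ideal I, ~ I 1
    & forall J : set R, is_ideal J -> (I `<=` J)%classic -> ~ J 1 -> J = I].

Definition noetherian : Prop := forall I : set R, is_ideal I -> ideal_fg I.

Definition integrally_closed : Prop :=
  forall x : {fraction R},
    integralOver (@tofrac R : R -> {fraction R}) x -> exists r : R, x = tofrac r.

(* Fields are allowed, as is customary; their class group is trivial. *)
Definition dedekind_domain : Prop :=
  [/\ noetherian, integrally_closed
    & forall I : set R, is_prime_ideal I -> (exists2 x, I x & x != 0) ->
        is_maximal_ideal I].

End Ideals.

Section ClassGroup.
Variable R : idomainType.

Definition module_fg (M : lmodType R) : Prop :=
  exists (k : nat) (g : 'I_k -> M),
    forall x : M, exists a : 'I_k -> R, x = \sum_i a i *: g i.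

Definition projective (P : lmodType R) : Prop :=
  forall (A B : lmodType R) (f : {linear A -> B}) (g : {linear P -> B}),
    (forall b : B, exists a : A, f a = b) ->
    exists h : {linear P -> A}, forall x, f (h x) = g x.

Definition lin_indep (M : lmodType R) (k : nat) (v : 'I_k -> M) : Prop :=
  forall a : 'I_k -> R, \sum_i a i *: v i = 0 -> forall i, a i = 0.

(* The rank of a module over a domain is the maximal number of linearly
   independent elements, that is, the dimension of its tensor product with the
   fraction field. *)
Definition module_rank (M : lmodType R) (r : nat) : Prop :=
  (exists v : 'I_r -> M, lin_indep v) /\
  (forall k (v : 'I_k -> M), lin_indep v -> (k <= r)%N).

Definition module_iso (M N : lmodType R) : Prop :=
  exists f : {linear M -> N}, bijective f.

Definition rank1_projective (P : lmodType R) : Prop :=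
  [/\ module_fg P, projective P & module_rank P 1].

(* cl(R) has exactly h elements: P lists one representative of each
   isomorphism class.  Only the cardinality of cl(R) is used. *)
Definition class_number (h : nat) : Prop :=
  exists P : 'I_h -> lmodType R,
    [/\ forall i, rank1_projective (P i),
        forall i j, module_iso (P i) (P j) -> i = j
      & forall Q, rank1_projective Q -> exists i, module_iso (P i) Q].

End ClassGroup.

Section OrderComplex.
Variables (d : Order.disp_t) (P : porderType d).

(* The simplices with p vertices (of dimension p - 1); the empty simplex,
   p = 0, is included, which makes the chain complex the augmented one. *)
Definition simplex (p : nat) : Type :=
  {s : seq P | sorted <%O s && (size s == p)}.

HB.instance Definition _ p := Choice.on (simplex p).

Lemma face_subproof p (i : 'I_p) (s : simplex p) :
  let t := take i (val s) ++ drop i.+1 (val s) in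
  sorted <%O t && (size t == p.-1).
Proof.
case: s => s /= /andP[sS /eqP szs]; apply/andP; split.
  apply: (subseq_sorted lt_trans) sS.
  rewrite -[X in subseq _ X](cat_take_drop i).
  by rewrite cat_subseq // -add1n -drop_drop drop_subseq.
by rewrite size_cat size_takel ?size_drop ?szs; case: i => i /= hi; lia.
Qed.

Definition face p (i : 'I_p) (s : simplex p) : simplex p.-1 :=
  exist _ (take i (val s) ++ drop i.+1 (val s)) (face_subproof i s).

Definition chain (p : nat) := {freeg (simplex p)}.

Definition boundary (p : nat) : chain p -> chain p.-1 :=
  fglift (fun s => \sum_(i < p) (-1) ^+ i *: << face i s >>).

Lemma boundary_is_zmod_morphism p : zmod_morphism (@boundary p).
Proof. exact: lift_is_additive. Qed.

HB.instance Definition _ p := GRing.isZmodMorphism.Build (chain p) (chain p.-1)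
  (@boundary p) (@boundary_is_zmod_morphism p).

Definition is_cycle p : {pred chain p} := fun c => boundary c == 0.

Lemma is_cycle_zmod p : zmod_closed (@is_cycle p).
Proof.
split; first by apply/eqP; rewrite raddf0.
move=> x y /eqP hx /eqP hy; apply/eqP.
by rewrite raddfB /= hx hy subrr.
Qed.

HB.instance Definition _ p := GRing.isZmodClosed.Build (chain p)
  (@is_cycle p) (@is_cycle_zmod p).

Record cycles p := Cycle { cycle_val : chain p; _ : cycle_val \in @is_cycle p }.

HB.instance Definition _ p := [isSub for @cycle_val p].
HB.instance Definition _ p := [Choice of cycles p by <:].
HB.instance Definition _ p := [SubChoice_isSubZmodule of cycles p by <:].

Definition is_boundary p : {pred cycles p} :=
  fun z => `[< exists c : chain p.+1, boundary c = val z >].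

Lemma is_boundary_zmod p : zmod_closed (@is_boundary p).
Proof.
split; first by apply/asboolP; exists 0; rewrite raddf0.
move=> x y /asboolP[a ha] /asboolP[b hb]; apply/asboolP; exists (a - b).
by rewrite raddfB /= ha hb.
Qed.

HB.instance Definition _ p := GRing.isZmodClosed.Build (cycles p)
  (@is_boundary p) (@is_boundary_zmod p).

(* Reduced homology in degree p - 1, with integer coefficients. *)
Definition reduced_homology p : zmodType := {ideal_quot (@is_boundary p)}.

Definition homology_class p (z : cycles p) : reduced_homology p :=
  \pi_({ideal_quot (@is_boundary p)})%qT z.

End OrderComplex.

Definition generated_by (A : zmodType) (S : A -> Prop) : Prop :=
  forall x : A, exists (k : nat) (c : 'I_k -> int) (g : 'I_k -> A),
    (forall i, S (g i)) /\ x = \sum_i g i *~ c i.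

Fact isotropic_display : Order.disp_t. Proof. exact: (Order.Disp tt tt). Qed.

Section Isotropic.
Variables (K : fieldType) (m : nat) (G : 'M[K]_m).
Implicit Types U V W : {vspace 'rV[K]_m}.

Definition gram_form (x y : 'rV[K]_m) : K := (x *m G *m y^T) 0 0.

Definition isotropic V : Prop :=
  forall x y, x \in V -> y \in V -> gram_form x y = 0.

Definition isotropic_poset : Type :=
  {V : {vspace 'rV[K]_m} | (V != 0%VS) && `[< isotropic V >]}.

HB.instance Definition _ := Choice.on isotropic_poset.

Definition isotropic_le (V W : isotropic_poset) : bool := (val V <= val W)%VS.

Lemma isotropic_le_refl : reflexive isotropic_le.
Proof. by move=> V; exact: subvv. Qed.

Lemma isotropic_le_anti : antisymmetric isotropic_le.
Proof. by move=> V W h; apply/val_inj/eqP; rewrite eqEsubv. Qed.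

Lemma isotropic_le_trans : transitive isotropic_le.
Proof. by move=> V U W; exact: subv_trans. Qed.

HB.instance Definition _ := Order.Le_isPOrder.Build isotropic_display
  isotropic_poset isotropic_le_refl isotropic_le_anti isotropic_le_trans.

Lemma gram_form_sum (I J : finType) (P : pred I) (Q : pred J)
    (x : I -> 'rV[K]_m) (y : J -> 'rV[K]_m) :
  gram_form (\sum_(i | P i) x i) (\sum_(j | Q j) y j) =
  \sum_(i | P i) \sum_(j | Q j) gram_form (x i) (y j).
Proof.
rewrite /gram_form linear_sum /= !mulmx_suml summxE.
by apply: eq_bigr => i _; rewrite mulmx_sumr summxE.
Qed.

End Isotropic.

Section SignedPermutations.
Variable n : nat.

(* The element i + 1 of [n] is encoded as (i, false), and -(i + 1) as
   (i, true). *)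
Definition signed_index : finType := ('I_n * bool)%type.

Definition sneg (k : signed_index) : signed_index := (k.1, ~~ k.2).

Definition is_signed (s : {perm signed_index}) : bool :=
  [forall k, s (sneg k) == sneg (s k)].

Definition signed_perm : Type := {s : {perm signed_index} | is_signed s}.

HB.instance Definition _ := Finite.on signed_perm.

Definition sswap (i j : 'I_n) : {perm signed_index} :=
  (tperm (i, false) (j, false) * tperm (i, true) (j, true))%g.

Definition sflip (i : 'I_n) : {perm signed_index} :=
  tperm (i, false) (i, true).

Definition sgens : {set {perm signed_index}} :=
  [set s | [exists i : 'I_n, exists j : 'I_n,
              (j == i.+1 :> nat) && (s == sswap i j)]] :|:
  [set s | [exists i : 'I_n, (i.+1 == n) && (s == sflip i)]].

(* sgens ^+ k is the set of products of k elements of sgens.  The product of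
   permutations is composition in the opposite order, which is irrelevant here:
   reversing a word does not change its length. *)
Definition slength (s : {perm signed_index}) : nat :=
  match pselect (exists k, s \in (sgens ^+ k)%g) with
  | left h => ex_minn h
  | right _ => 0
  end.

Local Open Scope group_scope.

Lemma signedP (s : {perm signed_index}) :
  reflect (forall k, s (sneg k) = sneg (s k)) (is_signed s).
Proof. exact: 'forall_eqP. Qed.

Lemma snegK : involutive sneg.
Proof. by case=> k b; rewrite /sneg /= negbK. Qed.

Lemma is_signedM s t : is_signed s -> is_signed t -> is_signed (s * t).
Proof. by move=> /signedP hs /signedP ht; apply/signedP => k; rewrite !permM hs ht. Qed.

Lemma sswapE i j k b : sswap i j (k, b) = (tperm i j k, b).
Proof.
have eqc c l : tperm (i, c) (j, c) (l, c) = (tperm i j l, c).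
  case: tpermP => [[->]|[->]|/eqP h1 /eqP h2]; rewrite ?tpermL ?tpermR //.
  by rewrite tpermD // eq_sym; [move: h1|move: h2]; rewrite xpair_eqE eqxx andbT.
have nec c l : tperm (i, ~~ c) (j, ~~ c) (l, c) = (l, c).
  by rewrite tpermD // xpair_eqE; case: c; rewrite andbF.
by rewrite /sswap permM; case: b; rewrite ?(nec true) ?eqc ?(nec false).
Qed.

Lemma sflipE i k b : sflip i (k, b) = (k, b (+) (k == i)).
Proof.
rewrite /sflip; case: (eqVneq k i) => [->|ki].
  by case: b; rewrite ?tpermL ?tpermR.
by rewrite tpermD ?addbF // xpair_eqE eq_sym (negPf ki).
Qed.

Lemma sswap_signed i j : is_signed (sswap i j).
Proof. by apply/signedP => -[k b]; rewrite /sneg /= !sswapE. Qed.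

Lemma sflip_signed i : is_signed (sflip i).
Proof. by apply/signedP => -[k b]; rewrite /sneg /= !sflipE addNb. Qed.

Lemma sswapV i j : sswap i j * sswap i j = 1.
Proof. by apply/permP => -[k b]; rewrite permM !sswapE perm1 tpermK. Qed.

Lemma sswapC i j : sswap i j = sswap j i.
Proof. by apply/permP => -[k b]; rewrite !sswapE tpermC. Qed.

Lemma sswapJ i j s : is_signed s ->
  (sswap i j) ^ s = tperm (s (i, false)) (s (j, false)) *
                    tperm (sneg (s (i, false))) (sneg (s (j, false))).
Proof. by move=> /signedP hs; rewrite /sswap conjMg !tpermJ -!hs. Qed.

Lemma mem_sgens_swap (i j : 'I_n) : j = i.+1 :> nat -> sswap i j \in sgens.
Proof.
move=> h; rewrite !inE; apply/orP; left.
by apply/existsP; exists i; apply/existsP; exists j; rewrite h !eqxx.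
Qed.

Lemma mem_sgens_flip (i : 'I_n) : i.+1 = n -> sflip i \in sgens.
Proof.
by move=> h; rewrite !inE; apply/orP; right; apply/existsP; exists i; rewrite eqxx andbT; apply/eqP.
Qed.

Lemma sswap_gen (i j : 'I_n) : sswap i j \in <<sgens>>.
Proof.
wlog ij : i j / (i < j)%N => [hwlog|].
  case: (ltngtP i j) => [|ji|/val_inj <-]; first exact: hwlog.
    by rewrite sswapC; exact: hwlog.
  have -> : sswap i i = 1 by apply/permP => -[k b]; rewrite sswapE tperm1 !perm1.
  exact: group1.
case: j ij => j; elim: j => // j IH hj ij.
have hj' : (j < n)%N by exact: ltnW.
have adj : sswap (Ordinal hj') (Ordinal hj) \in <<sgens>>.
  by apply/mem_gen/mem_sgens_swap.
case: (eqVneq (nat_of_ord i) j) => [e|ne].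
  by have -> : i = Ordinal hj' by exact: val_inj.
have ij' : (i < j)%N by rewrite ltn_neqAle ne -ltnS.
have := groupJ (IH hj' ij') adj.
rewrite sswapJ ?sswap_signed // !sswapE /sneg /= tpermL tpermD //.
  by rewrite -val_eqE /= eq_sym.
by rewrite -val_eqE /= gtn_eqF // ltnS ltnW.
Qed.

Lemma sflip_gen (i : 'I_n) : sflip i \in <<sgens>>.
Proof.
have hn : (n.-1 < n)%N by rewrite prednK // (leq_ltn_trans _ (ltn_ord i)).
have hl : sflip (Ordinal hn) \in <<sgens>>.
  apply/mem_gen/mem_sgens_flip; rewrite /= prednK //.
  exact: leq_ltn_trans (ltn_ord i).
have := groupJ hl (sswap_gen (Ordinal hn) i).
by rewrite /sflip tpermJ !sswapE tpermL.
Qed.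

Lemma signed_gen (s : {perm signed_index}) : is_signed s -> s \in <<sgens>>.
Proof.
have [c] := ubnP #|[pred k | s k != k]|; elim: c s => // c IH s hc sg.
have sE := signedP _ sg.
case: (pickP [pred i | s (i, false) != (i, false)]) => [i /= hi|h]; last first.
  have -> : s = 1; last exact: group1.
  apply/permP => -[k b]; rewrite perm1; have /negbFE/eqP e := h k.
  by case: b => //; have := sE (k, false); rewrite /sneg /= e.
case e : (s (i, false)) => [j b].
pose g := (if b then sflip j else 1) * sswap j i.
have gE k c' : g (k, c') = (tperm j i k, c' (+) (b && (k == j))).
  rewrite /g permM; case: b {e g} => /=; first by rewrite sflipE sswapE.
  by rewrite perm1 sswapE addbF.
have gG : g \in <<sgens>>.
  by rewrite /g groupM ?sswap_gen //; case: ifP => _; rewrite ?group1 ?sflip_gen.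
have gS : is_signed g.
  by apply/signedP => -[k c']; rewrite /sneg /= !gE addNb.
rewrite -(groupMr _ gG); apply: IH; last exact: is_signedM.
rewrite -ltnS; apply: leq_trans hc; rewrite ltnS.
apply: proper_card; apply/properP; split.
  apply/fintype.subsetP => -[k c']; rewrite !inE permM; apply: contraNN => /eqP ek.
  have eqF k' : (k' == false) = ~~ k' by case: k'.
  have ski : k != i.
    apply: contraNN hi => /eqP ki; rewrite -ki; case: c' ek => [ek|-> //].
    have := sE (k, true); rewrite ek /sneg /= => ->; exact: eqxx.
  have skj : k != j.
    apply: contraNN ski => /eqP kj; apply/eqP.
    have ekb c2 : s (k, c2) = (k, c2).
      have := sE (k, c'); rewrite ek /sneg /=.
      by move: ek; case: c2; case: (c') => ? ?.
    have : s (i, false) = s (k, b) by rewrite e ekb kj.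
    by move/perm_inj => [->].
  by rewrite ek gE tpermD 1?eq_sym // (negPf skj) andbF addbF.
exists (i, false); first by rewrite inE.
by rewrite inE permM e gE tpermL eqxx andbT addbb eqxx.
Qed.

Lemma word_exists (s : {perm signed_index}) :
  is_signed s -> exists k, s \in sgens ^+ k.
Proof.
move=> /signed_gen/gen_prodgP[k [c hc ->]]; exists k.
elim: k c hc => [|k IH] c hc; first by rewrite big_ord0 expg0 inE.
rewrite big_ord_recl expgS; apply: mem_mulg; first exact: hc.
by apply: IH => i; exact: hc.
Qed.

Lemma slength_word s : is_signed s -> s \in sgens ^+ slength s.
Proof.
move=> hs; rewrite /slength; case: pselect => [h|/(_ (word_exists hs))//].
by case: ex_minnP.
Qed.

Definition sabs (s : {perm signed_index}) : {perm 'I_n} :=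
  insubd (1 : {perm 'I_n}) [ffun i => (s (i, false)).1].

Lemma sabsE s i : is_signed s -> sabs s i = (s (i, false)).1.
Proof.
move=> /signedP hs.
have inj : injective (fun i => (s (i, false)).1).
  move=> x y exy; case: (eqVneq (s (x, false)).2 (s (y, false)).2) => h.
    have : s (x, false) = s (y, false).
      by move: exy h; case: (s (x, false)) (s (y, false)) => ? ? [? ?] /= -> ->.
    by move/perm_inj => [].
  have : s (x, false) = s (sneg (y, false)).
    rewrite hs; move: exy h; case: (s (x, false)) (s (y, false)) => ? b1 [? b2] /= ->.
    by rewrite /sneg /=; case: b1 b2 => [] [].
  by move/perm_inj.
rewrite /sabs -pvalE insubdK; first by rewrite ffunE.
by apply/injectiveP => x y; rewrite !ffunE; exact: inj.
Qed.

Definition sparity (s : {perm signed_index}) : bool :=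
  odd_perm s (+) odd_perm (sabs s).

Lemma sparityM s t : is_signed s -> is_signed t ->
  sparity (s * t) = sparity s (+) sparity t.
Proof.
move=> hs ht; rewrite /sparity.
have -> : sabs (s * t) = sabs s * sabs t.
  apply/permP => i; rewrite permM !sabsE ?is_signedM // permM.
  case: (s (i, false)) => j [] //=.
  by have /signedP/(_ (j, false)) := ht; rewrite /sneg /= => ->.
by rewrite !odd_permM addbACA.
Qed.

Lemma sgens_signed s : s \in sgens -> is_signed s && sparity s.
Proof.
rewrite !inE => /orP[/existsP[i /existsP[j /andP[/eqP ji /eqP ->]]]|].
  have ij : i != j by rewrite -val_eqE /= ji ltn_eqF.
  rewrite sswap_signed /sparity /=.
  have -> : sabs (sswap i j) = tperm i j.
    by apply/permP => k; rewrite sabsE ?sswap_signed // sswapE.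
  by rewrite odd_permM !odd_tperm !xpair_eqE !eqxx !andbT ij.
case/existsP=> i /andP[_ /eqP ->]; rewrite sflip_signed /sparity /=.
have -> : sabs (sflip i) = 1.
  by apply/permP => k; rewrite sabsE ?sflip_signed // sflipE perm1.
by rewrite odd_perm1 odd_tperm xpair_eqE andbF.
Qed.

Lemma sparity_word s k : s \in sgens ^+ k -> is_signed s && (sparity s == odd k).
Proof.
elim: k s => [|k IH] s.
  rewrite expg0 inE => /eqP ->; apply/andP; split.
    by apply/signedP => i; rewrite !perm1.
  rewrite /sparity odd_perm1 /=.
  have -> : sabs 1 = 1; last by rewrite odd_perm1.
  apply/permP => i; rewrite sabsE ?perm1 //.
  by apply/signedP => j; rewrite !perm1.
rewrite expgS => /mulsgP[a b /sgens_signed/andP[ha pa] /IH/andP[hb /eqP pb] ->].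
by rewrite is_signedM // sparityM // pa pb /= eqxx.
Qed.

Lemma odd_slength s : is_signed s -> odd (slength s) = sparity s.
Proof. by move=> /slength_word/sparity_word/andP[_ /eqP]. Qed.

Lemma odd_slength_mul s t : s \in sgens -> is_signed t ->
  odd (slength (s * t)) = ~~ odd (slength t).
Proof.
move=> /sgens_signed/andP[hs ps] ht.
by rewrite !odd_slength ?is_signedM // sparityM // ps.
Qed.

(* The generator s_{i + 1}. *)
Definition sgen (i : 'I_n) : {perm signed_index} :=
  if insub i.+1 is Some j then sswap i j else sflip i.

Lemma mem_sgen i : sgen i \in sgens.
Proof.
rewrite /sgen; case: insubP => [j _ /= ji|]; first exact: mem_sgens_swap.
rewrite -leqNgt => h; apply: mem_sgens_flip.
by apply/eqP; rewrite eqn_leq h ltn_ord.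
Qed.

Lemma sgenV i : sgen i * sgen i = 1.
Proof.
rewrite /sgen; case: insubP => [j _ _|_]; first exact: sswapV.
exact: tperm2.
Qed.

Lemma sgenM_signed i (s : signed_perm) : is_signed (sgen i * val s).
Proof.
apply: is_signedM; last exact: valP.
by have /sgens_signed/andP[] := mem_sgen i.
Qed.

Definition sgen_mul i (s : signed_perm) : signed_perm :=
  exist _ (sgen i * val s) (sgenM_signed i s).

Lemma sgen_mulK i : involutive (sgen_mul i).
Proof. by move=> s; apply: val_inj; rewrite /= mulgA sgenV mul1g. Qed.

Close Scope group_scope.

End SignedPermutations.

Section Frames.
Variables (K : fieldType) (n m : nat) (G : 'M[K]_m).

Record frame := Frame {
  frame_line :> signed_index n -> {vspace 'rV[K]_m};
  frame_dim : forall k, \dim (frame_line k) = 1%N;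
  frame_isotropic : forall k l,
    isotropic G (frame_line k + frame_line l) <-> l <> sneg k }.

Variable L : frame.

(* L_{s([k])} *)
Definition frame_flag (s : {perm signed_index n}) (k : nat) :
    {vspace 'rV[K]_m} :=
  (\sum_(i < n | (i < k)%N) L (s (i, false)))%VS.

Lemma signedE (s : signed_perm n) k : val s (sneg k) = sneg (val s k).
Proof. by case: s => s /= /forallP/(_ k)/eqP. Qed.

Lemma frame_ortho k l x y :
  l <> sneg k -> x \in L k -> y \in L l -> gram_form G x y = 0.
Proof.
move=> lk xk yl; apply: ((frame_isotropic L k l).2 lk x y).
  exact: (subvP (addvSl _ _)).
exact: (subvP (addvSr _ _)).
Qed.

Lemma signed_opp (s : signed_perm n) (i j : 'I_n) :
  val s (j, false) <> sneg (val s (i, false)).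
Proof. by rewrite -signedE => /perm_inj. Qed.

Lemma frame_flagP (s : signed_perm n) (k : 'I_n) :
  (frame_flag (val s) k.+1 != 0%VS) &&
  `[< isotropic G (frame_flag (val s) k.+1) >].
Proof.
apply/andP; split.
  rewrite -subv0; apply/negP => h.
  have : (L (val s (k, false)) <= 0)%VS.
    by apply: subv_trans h; apply: (sumv_sup k).
  by rewrite subv0 -dimv_eq0 frame_dim.
apply/asboolP => x y /memv_sumP[a ha ->] /memv_sumP[b hb ->].
rewrite gram_form_sum big1 // => i hi; rewrite big1 // => j hj.
apply: frame_ortho (ha _ hi) (hb _ hj); exact: signed_opp.
Qed.

Definition frame_vertex (s : signed_perm n) (k : 'I_n) : isotropic_poset G :=
  exist _ (frame_flag (val s) k.+1) (frame_flagP s k).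

Lemma frame_vertex_lt (s : signed_perm n) (i j : 'I_n) :
  (i < j)%N -> (frame_vertex s i < frame_vertex s j)%O.
Proof.
move=> ij; rewrite lt_neqAle; apply/andP; split; last first.
  apply/subv_sumP => k hk; apply: (sumv_sup k) => //.
  exact: leq_trans hk (ltnW _).
apply/eqP => /(congr1 val) /= e.
have hL : (L (val s (j, false)) <= frame_flag (val s) i.+1)%VS.
  by rewrite e; apply: (sumv_sup j).
set a := val s (j, false) in hL.
suff /frame_isotropic : isotropic G (L a + L (sneg a)) by [].
have sK : involutive (@sneg n) by case=> k b; rewrite /sneg /= negbK.
have sE (k : 'I_n) : (k < i.+1)%N -> sneg a <> sneg (val s (k, false)).
  move=> hk /(inv_inj sK)/perm_inj[] jk.
  by move: ij; rewrite jk ltnNge -ltnS hk.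
have ortho x y : x \in L a -> y \in L (sneg a) ->
    gram_form G x y = 0 /\ gram_form G y x = 0.
  move=> /(subvP hL)/memv_sumP[b hb ->] hy.
  have -> : y = \sum_(k < 1) y by rewrite big_ord1.
  rewrite !gram_form_sum big_ord1; split; rewrite big1 // => k hk.
    rewrite big_ord1; apply: frame_ortho (hb _ hk) hy; exact: sE.
  apply: frame_ortho hy (hb _ hk); rewrite sK => ak.
  by apply: (sE k hk); rewrite -ak.
move=> x y /memv_addP[x1 hx1 [x2 hx2 ->]] /memv_addP[y1 hy1 [y2 hy2 ->]].
have addl u v w : gram_form G (u + v) w = gram_form G u w + gram_form G v w.
  by rewrite /gram_form !mulmxDl mxE.
have addr u v w : gram_form G w (u + v) = gram_form G w u + gram_form G w v.
  by rewrite /gram_form linearD mulmxDr mxE.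
have self (k : signed_index n) : k <> sneg k by case: k => k [] [].
rewrite addl !addr (ortho _ _ hx1 hy2).1 (ortho _ _ hy1 hx2).2.
by rewrite (frame_ortho (@self a) hx1 hy1) (frame_ortho (@self _) hx2 hy2) !addr0.
Qed.

Lemma frame_simplex_subproof (s : signed_perm n) :
  let t := [seq frame_vertex s k | k <- enum 'I_n] in
  sorted <%O t && (size t == n).
Proof.
apply/andP; split; last by rewrite size_map size_enum_ord.
apply: (homo_sorted (e := fun i j : 'I_n => (i < j)%N)).
  by move=> i j; exact: frame_vertex_lt.
have := iota_ltn_sorted 0 n; rewrite -val_enum_ord.
by rewrite sorted_map.
Qed.

Definition frame_simplex (s : signed_perm n) :
    simplex (isotropic_poset G) n :=
  exist _ [seq frame_vertex s k | k <- enum 'I_n] (frame_simplex_subproof s).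

Definition apartment_chain : chain (isotropic_poset G) n :=
  \sum_(s : signed_perm n) (-1) ^+ slength (val s) *: << frame_simplex s >>.

Lemma frame_flag_sgen (s : {perm signed_index n}) (i l : 'I_n) :
  l != i -> frame_flag (sgen i * s)%g l.+1 = frame_flag s l.+1.
Proof.
move=> li; rewrite /frame_flag /sgen; case: insubP => [j _ /= ji|h].
  rewrite [RHS](reindex_inj (@perm_inj _ (tperm i j))) /=.
  apply: eq_big => [k|k _]; last by rewrite permM sswapE.
  have {}li : (l : nat) <> i by move=> /val_inj/eqP; rewrite (negPf li).
  case: tpermP => [->|->|//]; lia.
apply: eq_bigr => k kl; rewrite permM sflipE; case: eqP => // ki.
have {}li : (l : nat) <> i by move=> /val_inj/eqP; rewrite (negPf li).
have := ltn_ord l; move: kl h; rewrite ki; lia.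
Qed.

Lemma face_sgen (s : signed_perm n) (i : 'I_n) :
  face i (frame_simplex (sgen_mul i s)) = face i (frame_simplex s).
Proof.
apply: val_inj; rewrite /= -!map_take -!map_drop -!map_cat.
apply/eq_in_map => l hl; apply: val_inj; apply: frame_flag_sgen.
apply: contraTneq hl => ->.
have szi : (i < size (enum 'I_n))%N by rewrite size_enum_ord.
have := enum_uniq 'I_n; rewrite -[X in uniq X](cat_take_drop i).
rewrite (drop_nth i szi) nth_ord_enum -cat1s uniq_catCA cat1s /=.
by rewrite map_id -enumT; case/andP.
Qed.

Lemma apartment_is_cycle : apartment_chain \in is_cycle (P:=isotropic_poset G) (p:=n).
Proof.
apply/eqP; rewrite /apartment_chain raddf_sum /=.
have bdZ (e : int) s : boundary (e *: << frame_simplex s >>) =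
    \sum_(i < n) e *: ((-1) ^+ i *: << face i (frame_simplex s) >>).
  have -> : e *: << frame_simplex s >> = << e *g frame_simplex s >>
              :> {freeg (simplex (isotropic_poset G) n)}.
    by apply/eqP/freeg_eqP => x; rewrite coeffZ !coeffU mul1r.
  by rewrite /boundary liftU scaler_sumr.
under eq_bigr => s _ do rewrite bdZ.
rewrite exchange_big /= big1 // => i _.
set S := \sum_(s : signed_perm n) _.
have SN : S = - S.
  rewrite {1}/S (reindex_inj (can_inj (sgen_mulK i))) /= /S -sumrN.
  apply: eq_bigr => s _; rewrite face_sgen -scaleNr; congr (_ *: _).
  rewrite -[LHS]signr_odd -[in RHS]signr_odd.
  rewrite (odd_slength_mul (mem_sgen i) (valP s)).
  by case: (odd _); rewrite /= ?expr0 ?expr1 ?opprK.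
apply/eqP/freeg_eqP => x; rewrite coeff0.
have : coeff x S = - coeff x S by rewrite {1}SN raddfN.
lia.
Qed.

(* [Sigma_L], for the given indexing of the lines of L. *)
Definition apartment_class : reduced_homology (isotropic_poset G) n :=
  homology_class (Cycle apartment_is_cycle).

End Frames.

Section Symplectic.
Variable R : idomainType.

(* Non-degeneracy means a trivial radical; unimodularity is not required. *)
Definition symplectic_form m (w : {biscalar 'rV[R]_m}) : Prop :=
  (forall x, w x x = 0) /\ (forall x, (forall y, w x y = 0) -> x = 0).

Definition to_frac m (x : 'rV[R]_m) : 'rV[{fraction R}]_m :=
  map_mx (@tofrac R) x.

Definition gram m (w : {biscalar 'rV[R]_m}) : 'M[{fraction R}]_m :=
  \matrix_(i, j) tofrac (w (delta_mx 0 i) (delta_mx 0 j)).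

(* gram_form (gram w) is the bilinear extension of w to the fraction field. *)
Lemma gram_formE m (w : {biscalar 'rV[R]_m}) (x y : 'rV[R]_m) :
  gram_form (gram w) (to_frac x) (to_frac y) = tofrac (w x y).
Proof.
have -> : w x y = \sum_i \sum_j
    x 0 i * (y 0 j * w (delta_mx 0 i) (delta_mx 0 j)).
  rewrite {1}(row_sum_delta x) linear_sumlz; apply: eq_bigr => i _.
  rewrite linearZl_LR {1}(row_sum_delta y) linear_sumr mulr_sumr.
  by apply: eq_bigr => j _; rewrite linearZr_LR.
rewrite rmorph_sum /gram_form mxE.
under [LHS]eq_bigr => j _ do rewrite mxE mulr_suml.
rewrite exchange_big; apply: eq_bigr => i _ /=.
rewrite rmorph_sum; apply: eq_bigr => j _.
by rewrite !rmorphM !mxE -mulrA [X in _ * X]mulrC.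
Qed.

Definition symplectic_steinberg n (w : {biscalar 'rV[R]_(2 * n)}) : zmodType :=
  reduced_homology (isotropic_poset (gram w)) n.

(* Internal direct sum of the R-submodules L k `&` R^(2n). *)
Definition integral_frame n (w : {biscalar 'rV[R]_(2 * n)})
    (L : frame n (gram w)) : Prop :=
  forall x : 'rV[R]_(2 * n),
    exists! y : {ffun signed_index n -> 'rV[R]_(2 * n)},
      (forall k, to_frac (y k) \in L k) /\ x = \sum_k y k.

Definition integral_apartment_class n (w : {biscalar 'rV[R]_(2 * n)})
    (a : symplectic_steinberg w) : Prop :=
  exists2 L : frame n (gram w), integral_frame L & a = apartment_class L.

End Symplectic.

(* Main.v *)
Require Import Defs.
From HB Require Import structures.
From mathcomp Require Import all_boot all_order all_fingroup all_algebra.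
From mathcomp Require Import freeg ring zify.
From mathcomp Require Import boolp classical_sets.

Set Implicit Arguments.
Unset Strict Implicit.
Unset Printing Implicit Defensive.

Import Order.TTheory GRing.Theory.

Local Open Scope ring_scope.

(* Choose an isotropic plane [W] (all of [K^2] if [n = 1]) whose lattice
   [W :&: R^(2n)] is free, and a flag [W = W_2 < ... < W_n].  The functional
   counting the flags [V_1 < W_2 < ... < W_n] with [V_1 :&: R^(2n)] free of
   rank 1 vanishes on an integral apartment: such flags come in pairs
   [L_i, L_j] of opposite sign with [W = L_i + L_j], and if [I (+) J = R^2],
   then [I] is free if and only if [J] is.  It does not vanish on the apartment
   of a frame with two lines in [W] of which exactly one is free; such lines
   exist since [R] is not principal.  As isotropic subspaces have dimension at
   most [n], there are no boundaries in degree [n - 1], so the functional is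
   defined on homology.

   As the form may fail to be unimodular, finding [W] takes a unimodular vector
   orthogonal to a given [(p, q, r)] in [R^3]; it comes from
   [(p, q, r) = (p, q + t r)] for some [t], when [p != 0]. *)

(** * Ideals of Noetherian domains *)

Section Ideals.
Local Open Scope classical_set_scope.
Variable R : idomainType.
Implicit Types (I J K m : set R) (a b c p q r w x y z : R).

Definition principal a : set R := [set b | exists c, b = c * a].

Definition ideal_add I J : set R :=
  [set z | exists2 x, I x & exists2 y, J y & z = x + y].

Definition colon I a : set R := [set x | I (a * x)].

Lemma is_ideal_principal a : is_ideal (principal a).
Proof.
split; first by exists 0; ring.
  by move=> _ _ [x ->] [y ->]; exists (x + y); ring.
by move=> c _ [x ->]; exists (c * x); ring.
Qed.

Lemma mem_principal a : principal a a. Proof. by exists 1; ring. Qed.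

Lemma principal_sub I a : is_ideal I -> I a -> principal a `<=` I.
Proof. by move=> [_ _ IM] Ia _ [c ->]; exact: IM. Qed.

Lemma is_ideal_add I J : is_ideal I -> is_ideal J -> is_ideal (ideal_add I J).
Proof.
move=> [I0 ID IM] [J0 JD JM]; split.
- by exists 0 => //; exists 0 => //; ring.
- move=> _ _ [x Ix [y Jy ->]] [x' Ix' [y' Jy' ->]].
  by exists (x + x'); [exact: ID|exists (y + y'); [exact: JD|ring]].
move=> c _ [x Ix [y Jy ->]].
by exists (c * x); [exact: IM|exists (c * y); [exact: JM|ring]].
Qed.

Lemma ideal_addl I J : is_ideal J -> I `<=` ideal_add I J.
Proof. by move=> [J0 _ _] x Ix; exists x => //; exists 0 => //; ring. Qed.

Lemma ideal_addr I J : is_ideal I -> J `<=` ideal_add I J.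
Proof. by move=> [I0 _ _] y Jy; exists 0 => //; exists y => //; ring. Qed.

Lemma ideal_add_sub I J K : is_ideal K -> I `<=` K -> J `<=` K ->
  ideal_add I J `<=` K.
Proof. by move=> [_ KD _] IK JK _ [x /IK Kx [y /JK Ky ->]]; exact: KD. Qed.

Lemma is_ideal_colon I a : is_ideal I -> is_ideal (colon I a).
Proof.
move=> [I0 ID IM]; split; rewrite /colon /=; first by rewrite mulr0.
  by move=> x y ? ?; rewrite mulrDr; exact: ID.
by move=> c x ?; rewrite mulrCA; exact: IM.
Qed.

Definition ideal2 a b : set R := ideal_add (principal a) (principal b).

Lemma is_ideal2 a b : is_ideal (ideal2 a b).
Proof. by apply: is_ideal_add; exact: is_ideal_principal. Qed.

Lemma ideal2l a b : ideal2 a b a.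
Proof. by apply: ideal_addl (mem_principal a); exact: is_ideal_principal. Qed.

Lemma ideal2r a b : ideal2 a b b.
Proof. by apply: ideal_addr (mem_principal b); exact: is_ideal_principal. Qed.

Lemma ideal2_sub I a b : is_ideal I -> I a -> I b -> ideal2 a b `<=` I.
Proof.
by move=> Ii Ia Ib; apply: ideal_add_sub => //; exact: principal_sub.
Qed.

Lemma ideal_opp I x : is_ideal I -> I x -> I (- x).
Proof. by move=> [_ _ IM] /(IM (-1)); rewrite mulN1r. Qed.

Lemma ideal_sum_closed I (k : nat) (f : 'I_k -> R) :
  is_ideal I -> (forall i, I (f i)) -> I (\sum_i f i).
Proof. by move=> [I0 ID _] If; elim/big_ind: _. Qed.

Lemma mem_ideal_generator I (k : nat) (g : 'I_k -> R) :
  (forall x, I x <-> exists a : 'I_k -> R, x = \sum_i a i * g i) ->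
  forall i, I (g i).
Proof.
move=> gP i; apply/gP; exists (fun j => (j == i)%:R).
rewrite (bigD1 i) //= eqxx mul1r big1 ?addr0 // => j /negPf ->.
by rewrite mul0r.
Qed.

Lemma noetherian_acc (chain : nat -> set R) : noetherian R ->
  (forall k, is_ideal (chain k)) -> (forall k, chain k `<=` chain k.+1) ->
  exists M, forall k, chain k `<=` chain M.
Proof.
move=> noeth chain_ideal chainS.
have chain_le : {homo chain : k l / (k <= l)%N >-> k `<=` l}.
  by apply: (homo_leq (r := @subset R)) => [J|J I K|]; [|exact: subset_trans|].
have union_ideal : is_ideal [set x | exists k, chain k x].
  split; first by exists 0%N; have [] := chain_ideal 0%N.
    move=> x y [k kx] [l ly]; exists (maxn k l).
    have [_ ID _] := chain_ideal (maxn k l).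
    by apply: ID; [move: x kx|move: y ly];
      apply: chain_le; rewrite ?leq_maxl ?leq_maxr.
  by move=> a x [k kx]; exists k; have [_ _ IM] := chain_ideal k; exact: IM.
have [n [g gP]] := noeth _ union_ideal.
have /choice[N NP] i : exists l, chain l (g i).
  exact: mem_ideal_generator gP i.
exists (\max_i N i)%N => k x kx.
have [a ->] : exists a : 'I_n -> R, x = \sum_i a i * g i by apply/gP; exists k.
apply: ideal_sum_closed => // i; have [_ _ IM] := chain_ideal (\max_i N i)%N.
apply: IM; apply: chain_le (NP i); exact: (@leq_bigmax _ N i).
Qed.

Lemma noetherian_maximal (F : set (set R)) : noetherian R ->
  (forall I, F I -> is_ideal I) -> (exists I, F I) ->
  exists2 I, F I & forall J, F J -> I `<=` J -> J = I.
Proof.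
move=> noeth F_ideal [I0 FI0]; apply: contrapT => no_max.
have /choice[next nextP] I : exists J, F I -> [/\ F J, I `<=` J & J <> I].
  have [FI|nFI] := pselect (F I); last by exists I.
  apply: contrapT => nJ; apply: no_max; exists I => // J FJ IJ.
  by apply: contrapT => JI; apply: nJ; exists J.
pose chain k := iter k next I0.
have F_chain k : F (chain k) by elim: k => //= k /nextP[].
have chainS k : chain k `<=` chain k.+1 by have [] := nextP _ (F_chain k).
have [M chainM] := noetherian_acc noeth (fun k => F_ideal _ (F_chain k)) chainS.
have [_ _] := nextP _ (F_chain M); apply; apply/seteqP; split => //.
exact: chainM M.+1.
Qed.

Lemma exists_maximal_ideal I : noetherian R -> is_ideal I -> ~ I 1 ->
  exists2 m, is_maximal_ideal m & I `<=` m.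
Proof.
move=> noeth Ii I1.
pose F : set (set R) := [set J | [/\ is_ideal J, ~ J 1 & I `<=` J]].
have [|/=|m [mi m1 Im] m_max] := @noetherian_maximal F noeth.
- by move=> J [].
- by exists I; split.
exists m => //; split=> // J Ji mJ J1; apply: m_max => //; split=> // x /Im.
exact: mJ.
Qed.

Lemma maximal_ideal_comaximal m w : is_maximal_ideal m -> ~ m w ->
  ideal_add m (principal w) 1.
Proof.
move=> [mi m1 m_max] mw; apply: contrapT => nJ1; apply: mw.
have wi := is_ideal_principal w.
rewrite -(m_max _ (is_ideal_add mi wi) (ideal_addl wi) nJ1).
by apply: (ideal_addr mi); exact: mem_principal.
Qed.

Lemma maximal_ideal_prime m : is_maximal_ideal m -> is_prime_ideal m.
Proof.
move=> mm; have [mi m1 _] := mm; split=> // x y mxy.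
apply: contrapT => /not_orP[mx my]; have [_ mD mM] := mi.
have [n mn [_ [c ->] e]] := maximal_ideal_comaximal mm mx.
apply: my; have -> : y = y * n + c * (x * y) by rewrite -[LHS]mulr1 e; ring.
by apply: mD; apply: mM.
Qed.

Definition saturation m I : set R :=
  [set x | exists2 w, ~ m w & I (w * x)].

Lemma is_ideal_saturation m I : is_prime_ideal m -> is_ideal I ->
  is_ideal (saturation m I).
Proof.
move=> [mi m1 mP] [I0 ID IM]; split.
- by exists 1 => //; rewrite mulr0.
- move=> x y [w mw wx] [w' mw' wy]; exists (w * w'); first by move/mP => [].
  have -> : w * w' * (x + y) = w' * (w * x) + w * (w' * y) by ring.
  by apply: ID; apply: IM.
by move=> a x [w mw wx]; exists w => //; rewrite mulrCA; exact: IM.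
Qed.

Lemma saturation_annihilator m I : noetherian R -> is_prime_ideal m ->
  is_ideal I -> exists2 w, ~ m w & forall x, saturation m I x -> I (w * x).
Proof.
move=> noeth mp Ii; have [[mi m1 mP] [_ _ IM]] := (mp, Ii).
have [k [g gP]] := noeth _ (is_ideal_saturation mp Ii).
have /choice[w wP] i : exists w, ~ m w /\ I (w * g i).
  by have [w] := mem_ideal_generator gP i; exists w.
exists (\prod_i w i).
  by elim/big_ind: _ => // [x y mx my /mP[] //|i _]; have [] := wP i.
move=> x /gP[a ->]; rewrite mulr_sumr; apply: ideal_sum_closed => // i.
have -> : (\prod_j w j) * (a i * g i) =
    (\prod_(j | j != i) w j * a i) * (w i * g i) by rewrite (bigD1 i) //=; ring.
by have [_] := wP i; exact: IM.
Qed.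

(* Cayley-Hamilton: [b / a] is an eigenvalue of the matrix of its action on
   generators of [J], hence integral. *)
Lemma principal_of_stable_ideal J a b : noetherian R -> integrally_closed R ->
  is_ideal J -> (exists2 x, J x & x != 0) -> a != 0 ->
  (forall x, J x -> exists2 y, J y & b * x = a * y) -> principal a b.
Proof.
move=> noeth integral_in_R Ji [x0 Jx0 x0n0] an0 bJ.
have [k [g gP]] := noeth _ Ji.
have Jg i : J (g i) by exact: mem_ideal_generator gP i.
have /choice[A AP] i : exists c : 'I_k -> R, b * g i = a * \sum_j c j * g j.
  have [y Jy ->] := bJ _ (Jg i).
  by have /gP[c ->] := Jy; exists c.
pose f : R -> {fraction R} := @tofrac R.
pose M : 'M[R]_k := \matrix_(i, j) A j i.
pose v : 'rV_k := \row_i f (g i).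
have fa : f a != 0 by rewrite tofrac_eq0.
have vM : v *m map_mx f M = (f b / f a) *: v.
  apply/rowP => i; rewrite !mxE; apply: (mulfI fa).
  rewrite mulrA mulrCA divff // mulr1 -rmorphM AP rmorphM rmorph_sum.
  by congr (_ * _); apply: eq_bigr => j _; rewrite !mxE rmorphM mulrC.
have vn0 : v != 0.
  apply: contraNneq x0n0 => v0; have /gP[c ->] := Jx0.
  rewrite big1 // => i _; have /rowP/(_ i) := v0.
  by rewrite !mxE => /eqP; rewrite tofrac_eq0 => /eqP ->; rewrite mulr0.
have [|c e] := integral_in_R (f b / f a).
  exists (char_poly M); first exact: char_poly_monic.
  rewrite map_char_poly -eigenvalue_root_char.
  by apply/eigenvalueP; exists v.
by exists c; apply/eqP; rewrite -tofrac_eq rmorphM /= -e divfK.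
Qed.

End Ideals.

(** * Dedekind domains *)

Section Dedekind.
Local Open Scope classical_set_scope.
Variables (R : idomainType) (R_dedekind : dedekind_domain R).
Implicit Types (I J m : set R) (a b c d f p q r w x y z : R).

Let noeth : noetherian R. Proof. by case: R_dedekind. Qed.

(* [m] is an associated prime of [R / I], because it is minimal over [I]. *)
Lemma maximal_ideal_colon m I : is_maximal_ideal m -> is_ideal I ->
  (exists2 x, I x & x != 0) -> I `<=` m ->
  exists2 b, ~ I b & colon I b = m.
Proof.
move=> mm Ii [x0 Ix0 x0n0] Im.
have [mi m1 mP] := maximal_ideal_prime mm; have [_ _ IM] := Ii.
pose F : set (set R) := [set J | exists2 b, J = colon I b & J `<=` m].
have [||_ [b -> bm] bmax] := @noetherian_maximal _ F noeth.
- by move=> _ [b -> _]; exact: is_ideal_colon.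
- by exists (colon I 1); exists 1 => // x; rewrite /colon /= mul1r; exact: Im.
have absorb z : colon I (b * z) `<=` m -> colon I (b * z) = colon I b.
  move=> sub_m; apply: bmax; first by exists (b * z).
  by move=> y; rewrite /colon /= mulrAC [b * y * z]mulrC; exact: IM.
have b_prime : is_prime_ideal (colon I b).
  split=> [|/bm//|x y bxy]; first exact: is_ideal_colon.
  apply: contrapT => /not_orP[bx b_y].
  have [/absorb bxE|] := pselect (colon I (b * x) `<=` m).
    by apply: b_y; rewrite -bxE /colon /= -mulrA.
  move=> /existsNP[z /not_implyP[bxz mz]]; apply: bx.
  rewrite -(@absorb z) /colon /= 1?mulrAC // => y'.
  by rewrite /= -mulrA => /bm/mP[].
have [_ _ dim1] := R_dedekind.
have [|_ _ cmax] := dim1 _ b_prime.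
  by exists x0 => //; rewrite /colon /=; exact: IM.
exists b; last by apply/esym/cmax.
by move=> Ib; apply/m1/bm; rewrite /colon /= mulr1.
Qed.

Lemma locally_comparable m q r : is_maximal_ideal m ->
  exists2 x, ~ m x & principal r (x * q) \/ principal q (x * r).
Proof.
move=> mm; have [mi m1 _] := maximal_ideal_prime mm.
have [->|qn0] := eqVneq q 0.
  by exists 1 => //; left; exists 0; ring.
apply: contrapT => ncomp.
have relation_in_m y z : q * z = y * r -> m y /\ m z.
  move=> e; split; apply: contrapT => h; apply: ncomp.
    by exists y => //; right; exists z; rewrite -e mulrC.
  by exists z => //; left; exists y; rewrite mulrC e.
have mq : m q by have [] := relation_in_m q r erefl.
have [||b qb bm] := maximal_ideal_colon mm (is_ideal_principal q).
- by exists q => //; exact: mem_principal.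
- exact: principal_sub.
have {}bm z : m z -> principal q (b * z) by rewrite -bm.
apply: qb; apply: (@principal_of_stable_ideal _ (colon (principal q) r)) => //.
- by have [] := R_dedekind.
- exact/is_ideal_colon/is_ideal_principal.
- by exists q => //=; exists r.
move=> y [z e].
have [/bm[y1 e1] /bm[z1 e2]] : m y /\ m z.
  by apply: relation_in_m; rewrite mulrC -e mulrC.
exists y1; last by rewrite e1 mulrC.
exists z1; apply: (mulfI qn0).
have -> : q * (r * y1) = r * (y1 * q) by ring.
by rewrite -e1 mulrCA e [b * _]mulrA e2; ring.
Qed.

Lemma saturation_comaximal m I w : is_prime_ideal m -> is_ideal I ->
  (exists2 x, I x & x != 0) -> ~ m w ->
  ideal_add (saturation m I) (principal w) 1.
Proof.
move=> mp Ii [x0 Ix0 x0n0] mw; apply: contrapT => not_comaximal.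
have [_ m1 mP] := mp.
have [si wi] := (is_ideal_saturation mp Ii, is_ideal_principal w).
have [m' m'_max sub_m'] :=
  exists_maximal_ideal noeth (is_ideal_add si wi) not_comaximal.
have [||b sb bm'] := maximal_ideal_colon m'_max si.
- by exists x0 => //; exists 1; rewrite ?mul1r.
- by move=> x sx; apply/sub_m'/ideal_addl.
have : m' w by apply/sub_m'/ideal_addr => //; exact: mem_principal.
rewrite -bm' => -[w' mw' Iw]; apply: sb.
exists (w' * w); first by move/mP => [].
by rewrite -mulrA [w * b]mulrC.
Qed.

(* [e] is an element outside [m] of [p R_n] for all maximal ideals [n != m], so
   that [(p, q)] and [(p, q + e r)] only differ at [m]. *)
Lemma ideal2_enlarge m p q r : p != 0 -> is_maximal_ideal m ->
  colon (ideal2 p q) r `<=` m ->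
  exists2 e, ~ m e &
    ideal2 p q `<=` ideal2 p (q + e * r) /\ ideal2 p (q + e * r) (e * r).
Proof.
move=> pn0 mm colon_m; have mp := maximal_ideal_prime mm.
have [[mi _ mP] [_ _ DM]] := (mp, is_ideal2 p q); have [_ mD _] := mi.
have [e me eP] := saturation_annihilator noeth mp (is_ideal_principal p).
have [x mx [[y xy]|[y xy]]] := locally_comparable q r mm; last first.
  case: mx; apply: colon_m; rewrite /colon /= mulrC xy.
  by apply: DM; exact: ideal2r.
have my : m y.
  by apply: colon_m; rewrite /colon /= mulrC -xy; apply: DM; exact: ideal2r.
have mw : ~ m (y + x * e).
  move=> mw; have : m (x * e).
    by rewrite -[x * e](addKr y) addrC; apply: mD => //; exact: ideal_opp.
  by move/mP => [].
have D'_ideal := is_ideal2 p (q + e * r); have [_ D'D D'M] := D'_ideal.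
have [D'p D'q] := (ideal2l p (q + e * r), ideal2r p (q + e * r)).
have D'er : ideal2 p (q + e * r) (e * r).
  have [|n /eP[c en] [_ [d ->] e1]] :=
    saturation_comaximal mp (is_ideal_principal p) _ mw.
    by exists p => //; exact: mem_principal.
  have erE : e * r = r * c * p + e * d * x * (q + e * r).
    have -> : e * d * x * (q + e * r) = e * (d * (y + x * e)) * r.
      by transitivity (e * d * (x * q + x * e * r)); [|rewrite xy]; ring.
    by rewrite -[r * c * p]mulrA -en -[LHS]mulr1 e1; ring.
  by rewrite {2}erE; apply: D'D; exact: D'M.
exists e => //; split=> //; apply: ideal2_sub => //.
by rewrite -[X in _ X](addrK (e * r)); apply: D'D => //; exact: ideal_opp.
Qed.

Lemma ideal_stable_range p q r : p != 0 -> exists t, ideal2 p (q + t * r) r.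
Proof.
move=> pn0; pose D t := ideal2 p (q + t * r).
pose F : set (set R) := [set I | exists t, I = D t].
have [||_ [t ->] t_max] := @noetherian_maximal _ F noeth.
- by move=> _ [t ->]; exact: is_ideal2.
- by exists (D 0), 0.
exists t; apply: contrapT => tr.
have [||m mm tm] := @exists_maximal_ideal _ (colon (D t) r) noeth.
- exact/is_ideal_colon/is_ideal2.
- by rewrite /colon /= mulr1.
have [e me [sub_e e_er]] := ideal2_enlarge pn0 mm tm.
apply/me/tm; rewrite /colon /= [r * e]mulrC -(t_max _ _ sub_e) //.
by exists (t + e); rewrite /D mulrDl addrA.
Qed.

Lemma orthogonal_unimodular p q r : exists x y z,
  x * p + y * q + z * r = 0 /\ exists a b c, a * x + b * y + c * z = 1.
Proof.
have [->|pn0] := eqVneq p 0.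
  by exists 1, 0, 0; split; [ring|exists 1, 0, 0; ring].
have [t [_ [a ->] [_ [b ->] e]]] := ideal_stable_range q r pn0.
exists (- a), (- b), (1 - b * t); split; last by exists 0, (- t), 1; ring.
have -> : - a * p + - b * q + (1 - b * t) * r = r - (a * p + b * (q + t * r)).
  by ring.
by rewrite -e subrr.
Qed.

Lemma comaximal_of_colon f d : d != 0 ->
  colon (principal d) f `<=` principal d -> ideal2 f d 1.
Proof.
move=> dn0 colon_d; apply: contrapT => not_comaximal.
have [m mm sub_m] := exists_maximal_ideal noeth (is_ideal2 f d) not_comaximal.
have [mi _ _] := mm.
have [||g dg gm] := maximal_ideal_colon mm (is_ideal_principal d).
- by exists d => //; exact: mem_principal.
- by apply: principal_sub => //; exact/sub_m/ideal2r.
apply/dg/colon_d; rewrite /colon /= mulrC.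
by have : m f by [exact/sub_m/ideal2l]; rewrite -gm.
Qed.

(* If [(b : a) = (d)], then [a = c f] and [b = c d], where [(d : f) = (d)]. *)
Lemma ideal2_principal a b d : b != 0 ->
  colon (principal b) a = principal d -> exists c, ideal2 a b = principal c.
Proof.
move=> bn0 colonE.
have [c bE] : principal d b by rewrite -colonE; exists a; rewrite mulrC.
have [f adE] : colon (principal b) a d by rewrite colonE; exact: mem_principal.
have dn0 : d != 0 by apply: contraNneq bn0 => d0; rewrite bE d0 mulr0.
have aE : a = c * f by apply: (mulIf dn0); rewrite adE bE; ring.
exists c; apply/seteqP; split.
  apply: ideal2_sub; first exact: is_ideal_principal.
    by exists f; rewrite mulrC.
  by exists d; rewrite bE mulrC.
have [|_ [x ->] [_ [y ->] e]] := comaximal_of_colon (f := f) dn0.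
  move=> z [h fz]; rewrite -colonE; exists h.
  by rewrite aE bE -mulrA fz; ring.
move=> _ [z ->]; exists (z * x * a); first by exists (z * x).
exists (z * y * b); first by exists (z * y).
by rewrite aE bE -[LHS]mulr1 e; ring.
Qed.

Definition principal_ideal_ring : Prop :=
  forall I, is_ideal I -> exists a, I = principal a.

Lemma principal_ideal_ring_of_colon :
  (forall a b, b != 0 -> exists d, colon (principal b) a = principal d) ->
  principal_ideal_ring.
Proof.
move=> colon_principal I Ii.
pose F : set (set R) := [set J | exists2 g, J = principal g & I g].
have [||_ [g -> Ig] g_max] := @noetherian_maximal _ F noeth.
- by move=> _ [g -> _]; exact: is_ideal_principal.
- by exists (principal 0); exists 0 => //; have [] := Ii.
exists g; apply/seteqP; split; last exact: principal_sub.
move=> x Ix; have [->|xn0] := eqVneq x 0; first by exists 0; ring.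
have [d colonE] := colon_principal g x xn0.
have [k kE] := ideal2_principal xn0 colonE.
rewrite -(g_max (principal k)) -?kE; first exact: ideal2r.
  exists k => //; apply: (ideal2_sub Ii Ig Ix).
  by rewrite kE; exact: mem_principal.
by apply: principal_sub; [exact: is_ideal2|exact: ideal2l].
Qed.

End Dedekind.

(** * Projective modules of rank 1 *)

Section RankOne.
Variable R : idomainType.
Implicit Types M P : lmodType R.

Lemma module_fg_surjection M : module_fg M ->
  exists k (F : {linear 'rV[R]_k -> M}), forall x, exists a, F a = x.
Proof.
move=> [k [g gP]]; exists k.
pose F (a : 'rV[R]_k) : M := \sum_i a 0 i *: g i.
have F_linear : linear F.
  move=> c x y; rewrite /F scaler_sumr -big_split; apply: eq_bigr => i _ /=.
  by rewrite !mxE scalerDl scalerA.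
exists (HB.pack_for {linear 'rV[R]_k -> M} F
  (GRing.isLinear.Build _ _ _ _ F F_linear)) => x.
have [a ->] := gP x; exists (\row_i a i); rewrite /= /F.
by apply: eq_bigr => i _; rewrite mxE.
Qed.

Lemma projective_fg_embedding P : module_fg P -> projective P ->
  exists k (h : {linear P -> 'rV[R]_k}), injective h.
Proof.
move=> /module_fg_surjection[k [F F_surj]] P_proj.
have [h hK] := P_proj _ _ F (idfun : {linear P -> P}) F_surj.
by exists k, h; exact: can_inj hK.
Qed.

Lemma rank1_functional_inj M (f : {linear M -> R^o}) v :
  (forall (a : R) (x : M), a *: x = 0 -> a = 0 \/ x = 0) ->
  module_rank M 1 -> f v != 0 -> injective f.
Proof.
move=> torsion_free [_ rank_le1] fv; apply: raddf_inj => x fx0.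
apply: contrapT => xn0; pose b (i : 'I_2) := if i == ord0 then v else x.
suff /rank_le1 : lin_indep b by [].
move=> a; rewrite big_ord_recl big_ord1 /b /= => e.
have a0 : a ord0 = 0.
  move/(congr1 f): e; rewrite linearD !linearZ /= fx0 scaler0 addr0 linear0.
  by move=> /eqP; rewrite mulf_eq0 (negPf fv) orbF => /eqP.
move: e; rewrite a0 scale0r add0r => /torsion_free[a1|//] i.
by case: (unliftP ord0 i) => [j|] -> //; rewrite (ord1 j).
Qed.

Lemma rank1_projective_functional P : rank1_projective P ->
  exists2 f : {linear P -> R^o}, injective f & exists x, f x != 0.
Proof.
move=> [fgP projP rankP].
have [k [h h_inj]] := projective_fg_embedding fgP projP.
have torsion_free (a : R) (x : P) : a *: x = 0 -> a = 0 \/ x = 0.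
  move=> /(congr1 h); rewrite linearZ linear0 => /rowP ahx.
  have [->|an0] := eqVneq a 0; [by left|right; apply: h_inj].
  apply/rowP => i; have /eqP := ahx i.
  by rewrite linear0 !mxE mulf_eq0 (negPf an0) => /eqP.
have [[v v_indep] _] := rankP.
have : h (v ord0) != 0.
  apply/eqP => hv0; suff /eqP : 1 = 0 :> R by rewrite oner_eq0.
  apply: (v_indep (fun=> 1) _ ord0); rewrite big_ord1 scale1r.
  by apply: h_inj; rewrite hv0 linear0.
move=> /rV0Pn[i hvi].
have coord_linear : linear (fun x => h x 0 i : R^o).
  by move=> a x y; rewrite linearP !mxE.
pose f := HB.pack_for {linear P -> R^o} (fun x => h x 0 i : R^o)
  (GRing.isLinear.Build _ _ _ _ (fun x => h x 0 i : R^o) coord_linear).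
by exists f; [exact: (rank1_functional_inj (v := v ord0))|exists (v ord0)].
Qed.

Lemma rank1_projective_free P : principal_ideal_ring R ->
  rank1_projective P -> module_iso R^o P.
Proof.
move=> pir /rank1_projective_functional[f f_inj [x0 fx0]].
have [|g imE] := pir (range f).
  split; first by exists 0; rewrite ?linear0.
    by move=> _ _ [x _ <-] [y _ <-]; exists (x + y); rewrite ?linearD.
  by move=> a _ [x _ <-]; exists (a *: x); rewrite ?linearZ.
have [p _ fp] : range f g by rewrite imE; exact: mem_principal.
have generated x : exists a, f x = a * g.
  by have : range f (f x) by []; rewrite imE.
have gn0 : g != 0.
  apply: contraNneq fx0 => g0; have [a ->] := generated x0.
  by rewrite g0 mulr0.
have scale_linear : linear (fun a : R^o => a *: p).
  by move=> a x y; rewrite scalerDl scalerA.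
exists (HB.pack_for {linear R^o -> P} (fun a : R^o => a *: p)
  (GRing.isLinear.Build _ _ _ _ (fun a : R^o => a *: p) scale_linear)).
have /choice[c fE] := generated.
exists (c : P -> R^o) => [a|x] /=.
  by apply: (mulIf gn0); rewrite -fE linearZ fp.
by apply: f_inj; rewrite linearZ fp [RHS]fE.
Qed.

Lemma module_iso_sym (M N : lmodType R) : module_iso M N -> module_iso N M.
Proof.
move=> [f [g fK gK]].
exists (HB.pack_for {linear N -> M} g
  (GRing.isLinear.Build _ _ _ _ g (can2_linear fK gK))).
by exists f.
Qed.

Lemma module_iso_trans (L M N : lmodType R) :
  module_iso L M -> module_iso M N -> module_iso L N.
Proof. by move=> [f f_bij] [g g_bij]; exists (g \o f); exact: bij_comp. Qed.

Lemma exists_nonprincipal_colon h : dedekind_domain R -> class_number R h ->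
  (2 <= h)%N -> exists a b : R, b != 0 /\
    ~ exists d, colon (principal b) a = principal d.
Proof.
move=> dR [P [rank1P isoP _]] h2; apply: contrapT => colon_principal.
have pir : principal_ideal_ring R.
  apply: (principal_ideal_ring_of_colon dR) => a b bn0.
  by apply: contrapT => nd; apply: colon_principal; exists a, b.
have iso i : module_iso R^o (P i) := rank1_projective_free pir (rank1P i).
have := isoP (Ordinal (ltnW h2)) (Ordinal h2).
by case/(_ (module_iso_trans (module_iso_sym (iso _)) (iso _))).
Qed.

End RankOne.

(** * Alternating forms and symplectic frames *)

Section Subspaces.
Variables (K : fieldType) (vT : vectType K).
Implicit Types (x y : vT) (V : {vspace vT}).

Lemma memv_lineDl x V : x \in (<[x]> + V)%VS.
Proof. exact: subvP (addvSl _ _) _ (memv_line x). Qed.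

Lemma memv_lineDr x V : x \in (V + <[x]>)%VS.
Proof. exact: subvP (addvSr _ _) _ (memv_line x). Qed.

Lemma dim1_vline V x : \dim V = 1%N -> x \in V -> x != 0 -> V = <[x]>%VS.
Proof.
move=> dimV xV xn0; apply/esym/eqP.
by rewrite eqEdim -memvE xV dimV dim_vline xn0.
Qed.

Lemma dim_addv_line x y : x != 0 -> y \notin <[x]>%VS ->
  (1 < \dim (<[x]> + <[y]>))%N.
Proof.
move=> xn0 yx; rewrite ltnNge; apply: contra yx => dim_xy.
have /eqP -> : (<[x]> == <[x]> + <[y]>)%VS.
  by rewrite eqEdim addvSl dim_vline xn0.
exact: memv_lineDr.
Qed.

End Subspaces.

Section SubspaceMatrix.
Variables (K : fieldType) (m : nat).
Implicit Types (x : 'rV[K]_m) (V : {vspace 'rV[K]_m}).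

Definition vbasis_mx V : 'M[K]_(\dim V, m) := \matrix_i (vbasis V)`_i.

Lemma mem_vbasis_mx V x : (x \in V) = (x <= vbasis_mx V)%MS.
Proof.
apply/idP/submxP => [xV|[a ->]].
  exists (\row_i coord (vbasis V) i x).
  rewrite mulmx_sum_row [LHS](coord_vbasis xV).
  by apply: eq_bigr => i _; rewrite rowK mxE.
rewrite mulmx_sum_row memv_suml // => i _; rewrite rowK memvZ //.
by apply: vbasis_mem; rewrite mem_nth ?size_tuple.
Qed.

Lemma row_free_vbasis_mx V : row_free (vbasis_mx V).
Proof.
apply: inj_row_free => a; rewrite mulmx_sum_row => a0.
have /freeP vbasis_free := basis_free (vbasisP V).
apply/rowP => i; rewrite mxE; apply: (vbasis_free (fun j => a 0 j)).
by rewrite -[RHS]a0; apply: eq_bigr => j _; rewrite rowK.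
Qed.

End SubspaceMatrix.

Section GramForm.
Variables (K : fieldType) (m : nat) (G : 'M[K]_m).
Implicit Types (x y z : 'rV[K]_m) (V : {vspace 'rV[K]_m}).

Local Notation B := (gram_form G).

Lemma gram_form_is_bilinear : bilinear_for
  (GRing.Scale.Law.clone _ _ *%R _) (GRing.Scale.Law.clone _ _ *%R _)
  (B : 'rV[K]_m -> 'rV[K]_m -> K).
Proof.
split=> z a x y; rewrite /gram_form.
  by rewrite !mulmxDl -!scalemxAl !mxE.
by rewrite linearP mulmxDr -scalemxAr !mxE.
Qed.

HB.instance Definition _ := bilinear_isBilinear.Build K _ _ _ _ _
  B gram_form_is_bilinear.

Lemma isotropic_dim V : G \in unitmx -> isotropic G V -> (2 * \dim V <= m)%N.
Proof.
move=> G_unit isoV; pose A := vbasis_mx V.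
have rankA : \rank A = \dim V by apply/eqP/row_free_vbasis_mx.
have rowV i : row i A \in V by rewrite mem_vbasis_mx row_sub.
have AGA : A *m G *m A^T = 0.
  apply/matrixP => i j; rewrite [RHS]mxE -[RHS](isoV _ _ (rowV i) (rowV j)).
  by rewrite /gram_form -row_mul !mxE; apply: eq_bigr => k _; rewrite !mxE.
have := mulmx0_rank_max AGA; rewrite mxrankMfree ?row_free_unit //.
by rewrite mxrank_tr rankA addnn mul2n.
Qed.

Lemma gram_form_separation V x : G \in unitmx -> x \notin V ->
  exists2 z, B x z = 1 & forall y, y \in V -> B y z = 0.
Proof.
move=> G_unit; rewrite mem_vbasis_mx; set A := vbasis_mx V => xA.
pose C := cokermx (A *m G); have BC y j : B y (col j C)^T = (y *m G *m C) 0 j.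
  by rewrite /gram_form trmxK colE mulmxA -colE mxE.
have /rV0Pn[j xCj] : x *m G *m C != 0.
  by rewrite -submxE submxMfree ?row_free_unit.
exists (((x *m G *m C) 0 j)^-1 *: (col j C)^T).
  by rewrite linearZr_LR /= BC mulVf.
move=> y; rewrite mem_vbasis_mx => /submxP[a ->].
have aAGC : a *m A *m G *m C = 0.
  by rewrite -!mulmxA [A *m _]mulmxA mulmx_coker mulmx0.
by rewrite linearZr_LR /= BC aAGC [X in _ * X]mxE mulr0.
Qed.

Hypothesis G_alt : forall x, B x x = 0.

Lemma gram_formC x y : B x y = - B y x.
Proof.
have := G_alt (x + y); rewrite linearDl /= !linearDr /= !G_alt add0r addr0.
by move/eqP; rewrite addr_eq0 => /eqP.
Qed.

Lemma isotropic_lines x y : B x y = 0 -> isotropic G (<[x]> + <[y]>)%VS.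
Proof.
move=> xy x1 y1 /memv_addP[_ /vlineP[a ->] [_ /vlineP[b ->] ->]].
move=> /memv_addP[_ /vlineP[c ->] [_ /vlineP[d ->] ->]].
rewrite linearDl /= !linearDr /= !linearZl_LR !linearZr_LR /=.
by rewrite !G_alt xy (gram_formC y x) xy oppr0 !mulr0 !addr0.
Qed.

Lemma exists_orthogonal V : G \in unitmx -> (\dim V < m)%N ->
  exists2 x, x != 0 & forall y, y \in V -> B x y = 0.
Proof.
move=> G_unit dimV; have /subvPn[x _ xV] : ~~ (fullv <= V)%VS.
  rewrite -(geq_leqif (dimv_leqif_sup (subvf V))) dimvf /dim /= mul1n.
  by rewrite -ltnNge.
have [z xz zV] := gram_form_separation G_unit xV.
exists z; last by move=> y yV; rewrite gram_formC zV ?oppr0.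
by apply/eqP => z0; move/eqP: xz; rewrite z0 linear0r eq_sym oner_eq0.
Qed.

End GramForm.

Section HyperbolicBasis.
Variables (K : fieldType) (n m : nat) (G : 'M[K]_m).
Hypothesis G_unit : G \in unitmx.
Hypothesis G_alt : forall x, gram_form G x x = 0.
Implicit Types (x y z : 'rV[K]_m) (J : {set 'I_n}).
Implicit Types (b : signed_index n -> 'rV[K]_m).

Local Notation B := (gram_form G).

Definition hyperbolic J b : Prop := forall k l, k.1 \in J -> l.1 \in J ->
  B (b k) (b l) = if l == sneg k then (-1) ^+ k.2 else 0.

Lemma hyperbolic0 b : hyperbolic finset.set0 b.
Proof. by move=> k l; rewrite inE. Qed.

Definition update_pair b i x y : signed_index n -> 'rV[K]_m :=
  fun k => if k.1 == i then if k.2 then y else x else b k.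

Lemma hyperbolic_update_pair J b i x y : hyperbolic J b -> B x y = 1 ->
  (forall k, k.1 \in J -> B (b k) x = 0 /\ B (b k) y = 0) ->
  hyperbolic (i |: J)%SET (update_pair b i x y).
Proof.
move=> hb xy orth k l; rewrite !in_setU1 /update_pair.
have [k1i _|k1i /= kJ] := eqVneq k.1 i; have [l1i _|l1i /= lJ] := eqVneq l.1 i.
- case: k l k1i l1i => [k1 s] [l1 t] /= -> ->; rewrite /sneg xpair_eqE eqxx /=.
  by case: s; case: t; rewrite //= ?G_alt // gram_formC ?xy.
- rewrite [RHS]ifN; last by apply: contraNneq l1i => ->; rewrite /= k1i.
  have [bx b_y] := orth _ lJ.
  by case: ifP; rewrite gram_formC // (bx, b_y) oppr0.
- rewrite [RHS]ifN; last by apply: contraNneq k1i => lk; rewrite -l1i lk.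
  by have [bx b_y] := orth _ kJ; case: ifP.
exact: hb.
Qed.

Definition hyperbolic_span J b : {vspace 'rV[K]_m} :=
  (\sum_(k | k.1 \in J) <[b k]>)%VS.

Lemma mem_hyperbolic_span J b k : k.1 \in J -> b k \in hyperbolic_span J b.
Proof. by move=> kJ; rewrite memvE; exact: (sumv_sup k). Qed.

Lemma hyperbolic_nondegenerate J b x : hyperbolic J b ->
  x \in hyperbolic_span J b -> (forall k, k.1 \in J -> B x (b k) = 0) -> x = 0.
Proof.
move=> hb /memv_sumP[a aE ->] orth; apply: big1 => k kJ.
have [c ak] := vlineP _ _ (aE k kJ).
have := orth (sneg k) kJ; rewrite linear_sumlz (bigD1 k) //= big1 ?addr0.
  rewrite ak linearZl_LR /= hb // eqxx /= => /eqP.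
  by rewrite mulf_eq0 signr_eq0 orbF => /eqP ->; rewrite scale0r.
move=> l /andP[lJ lk]; have [d ->] := vlineP _ _ (aE l lJ).
rewrite linearZl_LR /= hb //= (inj_eq (inv_inj (@snegK n))) eq_sym (negPf lk).
by rewrite mulr0.
Qed.

Lemma hyperbolic_extend J b i x : hyperbolic J b -> x != 0 ->
  (forall k, k.1 \in J -> B x (b k) = 0) ->
  exists y, hyperbolic (i |: J)%SET (update_pair b i x y).
Proof.
move=> hb xn0 orth; have xJ : x \notin hyperbolic_span J b.
  by apply: contraNN xn0 => xJ; apply/eqP; exact: hyperbolic_nondegenerate orth.
have [y xy bJy] := gram_form_separation G_unit xJ.
exists y; apply: hyperbolic_update_pair => // k kJ; split.
  by rewrite gram_formC // orth // oppr0.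
exact/bJy/mem_hyperbolic_span.
Qed.

Lemma dim_hyperbolic_span J b : (\dim (hyperbolic_span J b) <= 2 * #|J|)%N.
Proof.
rewrite /hyperbolic_span; apply: leq_trans (dimv_leq_sum _ _ _) _.
have -> : (2 * #|J|)%N = (\sum_(k : signed_index n | k.1 \in J) 1)%N.
  rewrite mulnC -card_bool -cardsT -cardsX -sum1_card.
  by apply: eq_bigl => -[i s]; rewrite finset.in_setX finset.in_setT andbT.
by apply: leq_sum => k _; rewrite dim_vline leq_b1.
Qed.

Lemma hyperbolic_complete J b : (2 * n <= m)%N -> hyperbolic J b ->
  exists2 b', hyperbolic [set: 'I_n] b' & forall k, k.1 \in J -> b' k = b k.
Proof.
move=> nm; have [d] := ubnP (n - #|J|); elim: d J b => // d IH J b Jd hb.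
case: (pickP [pred i | i \notin J]) => [i /= iJ|J_full]; last first.
  by exists b => // k l _ _; apply: hb; apply/negbFE/J_full.
have J_lt : (#|J| < n)%N.
  by have := max_card (mem (i |: J)%SET); rewrite cardsU1 iJ card_ord.
have [|x xn0 orth] :=
  exists_orthogonal G_alt (V := hyperbolic_span J b) G_unit.
  by apply: leq_ltn_trans (dim_hyperbolic_span _ _) _; lia.
have [|y hb'] := hyperbolic_extend i hb xn0.
  by move=> k kJ; exact/orth/mem_hyperbolic_span.
have [|b' hb'' b'b] := IH _ _ _ hb'; first by rewrite cardsU1 iJ; lia.
exists b' => // k kJ; rewrite b'b ?in_setU1 ?kJ ?orbT // /update_pair.
by rewrite ifN //; apply: contraNneq iJ => <-.
Qed.

Lemma hyperbolic_frame b : hyperbolic [set: 'I_n] b ->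
  exists L : frame n G, forall k, L k = <[b k]>%VS.
Proof.
move=> hb; have bE k l : B (b k) (b l) = if l == sneg k then (-1) ^+ k.2 else 0.
  by apply: hb; rewrite inE.
have dim1 k : \dim <[b k]> = 1%N.
  rewrite dim_vline; case: eqP => // bk0; have := bE k (sneg k).
  by rewrite eqxx bk0 linear0l => /esym/eqP; rewrite signr_eq0.
have isoE k l : isotropic G (<[b k]> + <[b l]>) <-> l <> sneg k.
  split=> [iso lk|/eqP lk]; last first.
    by apply: isotropic_lines; rewrite // bE (negPf lk).
  have /eqP := iso (b k) (b l) (memv_lineDl _ _) (memv_lineDr _ _).
  by rewrite bE lk eqxx signr_eq0.
by exists (Frame dim1 isoE).
Qed.

Lemma hyperbolic_pair_frame i x y : (2 * n <= m)%N -> B x y != 0 ->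
  exists L : frame n G, L (i, false) = <[x]>%VS /\ L (i, true) = <[y]>%VS.
Proof.
move=> nm xy; pose y' := (B x y)^-1 *: y.
have xy' : B x y' = 1 by rewrite linearZr_LR /= mulVf.
have [|b hb bE] := hyperbolic_complete nm
    (hyperbolic_update_pair (i := i) (hyperbolic0 (fun=> 0)) xy' _).
  by move=> k; rewrite inE.
have [L LE] := hyperbolic_frame hb; exists L.
have yn0 : y != 0 by apply: contraNneq xy => ->; rewrite linear0r.
have y'_line : <[y]>%VS = <[y']>%VS.
  apply: dim1_vline; first by rewrite dim_vline yn0.
    exact/memvZ/memv_line.
  by rewrite scaler_eq0 invr_eq0 negb_or xy.
by rewrite !LE !bE ?in_setU1 ?eqxx // /update_pair /= eqxx y'_line.
Qed.

Lemma isotropic_pair_frame i j x y : (2 * n <= m)%N -> i != j ->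
  x != 0 -> y \notin <[x]>%VS -> B x y = 0 ->
  exists L : frame n G, L (i, false) = <[x]>%VS /\ L (j, false) = <[y]>%VS.
Proof.
move=> nm ij xn0 yx xy; have [z yz xz] := gram_form_separation G_unit yx.
have [||t hb] := hyperbolic_extend i
    (hyperbolic_update_pair (i := j) (hyperbolic0 (fun=> 0)) yz _) xn0.
- by move=> k; rewrite inE.
- move=> k; rewrite in_setU1 inE orbF /update_pair => ->.
  by case: ifP => // _; rewrite xz ?memv_line.
have [b' hb' b'E] := hyperbolic_complete nm hb.
have [L LE] := hyperbolic_frame hb'; exists L.
rewrite !LE !b'E ?in_setU1 ?eqxx ?orbT // /update_pair /= !eqxx.
by rewrite eq_sym (negPf ij).
Qed.

End HyperbolicBasis.

Section FrameDecomposition.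
Variables (K : fieldType) (n m : nat) (G : 'M[K]_m).
Hypothesis G_alt : forall x, gram_form G x x = 0.
Variable L : frame n G.
Implicit Types (x : 'rV[K]_m) (S : pred (signed_index n)).

Lemma frame_dual k x : x \in L k -> x != 0 ->
  exists2 t, t \in L (sneg k) & gram_form G x t != 0.
Proof.
move=> xk xn0; apply: contrapT => no_dual.
have tn0 : vpick (L (sneg k)) != 0 by rewrite vpick0 -dimv_eq0 frame_dim.
suff /frame_isotropic : isotropic G (L k + L (sneg k)) by [].
rewrite (dim1_vline (frame_dim L k) xk xn0).
rewrite (dim1_vline (frame_dim L (sneg k)) (memv_pick _) tn0).
apply: (isotropic_lines G_alt); apply: contrapT => /eqP xt.
by apply: no_dual; exists (vpick (L (sneg k))); rewrite ?memv_pick.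
Qed.

Lemma frame_directv : directv (\sum_k L k).
Proof.
apply/directv_sum_independent => u uL u0 k _; apply: contrapT => /eqP ukn0.
have [t tk /eqP] := frame_dual (uL k isT) ukn0; apply.
rewrite -[RHS](linear0l (gram_form G) t) -u0 linear_sumlz (bigD1 k) //=.
rewrite [X in _ + X]big1 ?addr0 // => l lk; apply: frame_ortho (uL l isT) tk.
by move=> /(inv_inj (@snegK n)) kl; rewrite kl eqxx in lk.
Qed.

Lemma frame_component (y : signed_index n -> 'rV[K]_m) S k :
  (forall l, y l \in L l) -> \sum_l y l \in (\sum_(l | S l) L l)%VS ->
  ~~ S k -> y k = 0.
Proof.
move=> yL /memv_sumP[a aL ya] Sk.
pose a' l := if S l then a l else 0.
have a'L l : a' l \in L l by rewrite /a'; case: ifP => [/aL|_]; rewrite ?mem0v.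
have /directv_sum_unique/(_ y a' (fun l _ => yL l) (fun l _ => a'L l)) :=
  frame_directv.
rewrite ya /a' -big_mkcond eqxx => /esym/forallP/(_ k)/eqP.
by rewrite (negPf Sk).
Qed.

Lemma frame_line_sub S k : (L k <= \sum_(l | S l) L l)%VS -> S k.
Proof.
move=> LkS; apply: contraT => Sk.
suff : L k == 0%VS by rewrite -dimv_eq0 frame_dim.
rewrite -subv0 -(directv_sumP frame_directv k isT) subv_cap subvv /=.
apply: subv_trans LkS _; apply/subv_sumP => l Sl; apply: (sumv_sup l) => //.
by apply: contraNneq Sk => <-.
Qed.

Lemma frame_line_disjoint k l : k != l -> (L k :&: L l = 0)%VS.
Proof.
move=> kl; apply/eqP; rewrite -subv0 -(directv_sumP frame_directv k isT).
by apply: capvS (subvv _) _; apply: (sumv_sup l); rewrite // eq_sym.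
Qed.

End FrameDecomposition.

(** * Lines and planes in a lattice *)

Section FractionLattice.
Variables (R : idomainType) (m : nat).
Local Notation F := {fraction R}.
Implicit Types (x y u v : 'rV[R]_m) (a b c d p q s t : R).
Implicit Types (V W : {vspace 'rV[F]_m}).

HB.instance Definition _ := GRing.isZmodMorphism.Build 'rV[R]_m 'rV[F]_m
  (@to_frac R m) (raddfB (map_mx (@tofrac R))).

Lemma to_fracZ a x : to_frac (a *: x) = tofrac a *: to_frac x.
Proof. exact: map_mxZ. Qed.

Lemma to_frac_inj : injective (@to_frac R m).
Proof.
move=> x y /rowP xy; apply/rowP => i; apply/eqP; rewrite -tofrac_eq.
by have := xy i; rewrite !mxE => ->.
Qed.

Lemma exists_denominator (s : F) :
  exists2 d, d != 0 & exists a, tofrac d * s = tofrac a.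
Proof.
elim/quotW: s => r; exists r.2; first exact: denom_ratioP.
exists r.1; unlock tofrac; rewrite -[LHS]FracField.pi_mul.
apply/eqP; rewrite FracField.equivf_def /FracField.mulf.
by rewrite !numden_Ratio ?mul1r ?mulr1 ?oner_eq0 ?denom_ratioP.
Qed.

Lemma clear_denominators (x : 'rV[F]_m) :
  exists2 d, d != 0 & exists y, tofrac d *: x = to_frac y.
Proof.
have /choice[d dP] i :
    exists d, d != 0 /\ exists a, tofrac d * x 0 i = tofrac a.
  by have [d] := exists_denominator (x 0 i); exists d.
exists (\prod_i d i); first by apply/prodf_neq0 => i _; have [] := dP i.
have /choice[a aP] i : exists a, tofrac (\prod_j d j) * x 0 i = tofrac a.
  have [_ [a e]] := dP i; exists ((\prod_(j | j != i) d j) * a).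
  rewrite (bigD1 i) //= mulrC rmorphM mulrA [x 0 i * _]mulrC e -rmorphM.
  by rewrite mulrC.
by exists (\row_i a i); apply/rowP => i; rewrite !mxE aP.
Qed.

Lemma nonzero_lattice_vector V : V != 0%VS ->
  exists2 x, x != 0 & to_frac x \in V.
Proof.
rewrite -vpick0 => vn0; have [d dn0 [x e]] := clear_denominators (vpick V).
exists x; last by rewrite -e memvZ // memv_pick.
apply: contraNneq vn0 => x0; move: e; rewrite x0 raddf0 => /eqP.
by rewrite scaler_eq0 tofrac_eq0 (negPf dn0).
Qed.

Definition frac_plane u v : {vspace 'rV[F]_m} :=
  (<[to_frac u]> + <[to_frac v]>)%VS.

Lemma mem_frac_plane x u v : to_frac x \in frac_plane u v <->
  exists2 d, d != 0 & exists a b, d *: x = a *: u + b *: v.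
Proof.
split=> [/memv_addP[_ /vlineP[s ->] [_ /vlineP[t ->] e]]|[d dn0 [a [b e]]]].
  have [d dn0 [a ea]] := exists_denominator s.
  have [d' d'n0 [b eb]] := exists_denominator t.
  exists (d * d'); first by rewrite mulf_neq0.
  exists (d' * a), (d * b); apply: to_frac_inj.
  rewrite raddfD /= !to_fracZ !tofracM -ea -eb e scalerDr !scalerA.
  by congr (_ *: _ + _ *: _); ring.
have -> : to_frac x = (tofrac d)^-1 *: to_frac (a *: u + b *: v).
  by rewrite -e to_fracZ scalerA mulVf ?scale1r // tofrac_eq0.
by rewrite memvZ // raddfD /= !to_fracZ memv_add // memvZ // memv_line.
Qed.

Lemma mem_frac_line x u : to_frac x \in <[to_frac u]>%VS <->
  exists2 d, d != 0 & exists a, d *: x = a *: u.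
Proof.
have -> : <[to_frac u]>%VS = frac_plane u 0.
  by apply/esym/addv_idPl; rewrite -memvE raddf0 mem0v.
rewrite mem_frac_plane; split=> -[d dn0 [a]].
  by move=> [b]; rewrite scaler0 addr0; exists d => //; exists a.
by exists d => //; exists a, 0; rewrite scaler0 addr0.
Qed.

Lemma frac_plane_shear u v a b : b != 0 ->
  frac_plane u (a *: u + b *: v) = frac_plane u v.
Proof.
move=> bn0; apply/eqP; rewrite eqEsubv !subv_add !addvSl /= -!memvE.
apply/andP; split; apply/mem_frac_plane.
  by exists 1; [exact: oner_neq0|exists a, b; rewrite scale1r].
by exists b => //; exists (- a), 1; rewrite scale1r scaleNr addKr.
Qed.

Definition lattice_basis u v : Prop :=
  (forall a b, a *: u + b *: v = 0 -> a = 0 /\ b = 0) /\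
  (forall x, to_frac x \in frac_plane u v -> exists a b, x = a *: u + b *: v).

Definition unimodular v : Prop := exists c : 'cV[R]_m, v *m c = 1%:M.

Lemma lattice_basis_delta i v : unimodular v -> v 0 i = 0 ->
  lattice_basis (delta_mx 0 i) v.
Proof.
move=> [c vc] vi; pose g x := ((x - x 0 i *: delta_mx 0 i) *m c) 0 0.
have coord_i (a b : R) : (a *: delta_mx 0 i + b *: v) 0 i = a.
  by rewrite !mxE !eqxx vi mulr0 addr0 mulr1.
have gE a b : g (a *: delta_mx 0 i + b *: v) = b.
  by rewrite /g coord_i addrAC subrr add0r -scalemxAl vc !mxE mulr1.
have gZ d x : g (d *: x) = d * g x.
  by rewrite /g [(d *: x) 0 i]mxE -scalerA -scalerBr -scalemxAl mxE.
split=> [a b e|x /mem_frac_plane[d dn0 [a [b e]]]].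
  split; first by rewrite -(coord_i a b) e mxE.
  by rewrite -(gE a b) e -(scale0r 0) gZ mul0r.
have [ea eb] : a = d * x 0 i /\ b = d * g x.
  by rewrite -(coord_i a b) -{2}(gE a b) -e mxE gZ.
exists (x 0 i), (g x); apply/rowP => j; apply: (mulfI dn0).
have /rowP/(_ j) : d *: x = d *: (x 0 i *: delta_mx 0 i + g x *: v).
  by rewrite e ea eb scalerDr !scalerA.
by rewrite [LHS]mxE [RHS]mxE.
Qed.

Definition cyclic_lattice V : Prop := exists2 y, to_frac y \in V &
  forall x, to_frac x \in V -> exists c, x = c *: y.

Lemma disjoint_lattice_coef0 V W y z s : (V :&: W = 0)%VS -> y != 0 ->
  to_frac y \in V -> to_frac z \in W -> s *: y + z = 0 -> s = 0.
Proof.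
move=> VW0 yn0 yV zW e.
have sy : s *: y = - z by apply/eqP; rewrite -addr_eq0 e.
have : to_frac (s *: y) \in (V :&: W)%VS.
  by rewrite memv_cap {2}sy raddfN /= memvN zW andbT to_fracZ memvZ.
rewrite VW0 memv0 -(raddf0 (@to_frac R m)) => /eqP/to_frac_inj/rowP sy0.
have /rV0Pn[i yi] := yn0; have /eqP := sy0 i.
by rewrite !mxE mulf_eq0 (negPf yi) orbF => /eqP.
Qed.

Lemma unimodular_kernel a b p q c d : a * p + b * q = 1 -> c * p + d * q = 0 ->
  c = (a * d - b * c) * - q /\ d = (a * d - b * c) * p.
Proof.
move=> ab1 cd0; split; apply/eqP; rewrite -subr_eq0; apply/eqP.
  transitivity (c * (1 - (a * p + b * q)) + a * (c * p + d * q)); first by ring.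
  by rewrite ab1 cd0; ring.
transitivity (d * (1 - (a * p + b * q)) + b * (c * p + d * q)); first by ring.
by rewrite ab1 cd0; ring.
Qed.

Section LatticeBasis.
Variables u v : 'rV[R]_m.
Hypothesis uv_basis : lattice_basis u v.

Let uv_indep a b : a *: u + b *: v = 0 -> a = 0 /\ b = 0.
Proof. by have [indep _] := uv_basis; exact: indep. Qed.

Let uv_span x : to_frac x \in frac_plane u v -> exists a b, x = a *: u + b *: v.
Proof. by have [_] := uv_basis; exact. Qed.

Lemma lattice_basis_inj a b a' b' :
  a *: u + b *: v = a' *: u + b' *: v -> a = a' /\ b = b'.
Proof.
move=> e; have [|/eqP+ /eqP] := @uv_indep (a - a') (b - b').
  by rewrite !scalerBl addrACA e -opprD subrr.
by rewrite !subr_eq0 => /eqP -> /eqP ->.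
Qed.

Lemma lattice_basis_neq0 : u != 0.
Proof.
apply/eqP => u0; have [|/eqP] := @uv_indep 1 0.
  by rewrite u0 scaler0 scale0r addr0.
by rewrite oner_eq0.
Qed.

Lemma cyclic_lattice_line : cyclic_lattice <[to_frac u]>.
Proof.
exists u; first exact: memv_line.
move=> x xu; have [a [b xE]] := uv_span (subvP (addvSl _ _) _ xu).
have /mem_frac_line[d dn0 [c dx]] := xu; exists a.
have [_ /eqP] : d * a = c /\ d * b = 0.
  by apply: lattice_basis_inj; rewrite scale0r addr0 -dx xE scalerDr !scalerA.
by rewrite mulf_eq0 (negPf dn0) => /eqP b0; rewrite xE b0 scale0r addr0.
Qed.

Lemma mem_lattice_basis_line a b s t : b != 0 ->
  to_frac (s *: u + t *: v) \in <[to_frac (a *: u + b *: v)]>%VS <->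
  s * b = t * a.
Proof.
move=> bn0; split=> [/mem_frac_line[d dn0 [c]]|st].
  rewrite !scalerDr !scalerA => /lattice_basis_inj[sa tb].
  by apply: (mulfI dn0); rewrite mulrA sa mulrA tb; ring.
apply/mem_frac_line; exists b => //; exists t.
by rewrite !scalerDr !scalerA [b * s]mulrC st [t * b]mulrC.
Qed.

Lemma lattice_basis_notin_line a b : b != 0 ->
  to_frac (a *: u + b *: v) \notin <[to_frac u]>%VS.
Proof.
move=> bn0; apply/negP => /mem_frac_line[d dn0 [c]].
rewrite scalerDr !scalerA -[c *: u]addr0 -(scale0r v) => /lattice_basis_inj[_].
by apply/eqP; rewrite mulf_neq0.
Qed.

Lemma colon_principal_of_cyclic_lattice a b : b != 0 ->
  cyclic_lattice <[to_frac (a *: u + b *: v)]> ->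
  exists d, colon (principal b) a = principal d.
Proof.
move=> bn0 [y yL yP].
have [|c [d yE]] := @uv_span y.
  apply: (subvP _ _ yL); rewrite -memvE; apply/mem_frac_plane.
  by exists 1; [exact: oner_neq0|exists a, b; rewrite scale1r].
have cd : c * b = d * a by apply/mem_lattice_basis_line; rewrite -?yE.
exists d; apply/seteqP; split=> [t [s ats]|_ [e ->]]; last first.
  by exists (e * c); rewrite mulrCA -[RHS]mulrA cd [d * a]mulrC.
have [|f] := yP (s *: u + t *: v).
  by apply/(mem_lattice_basis_line _ _ _ bn0); rewrite -ats mulrC.
by rewrite yE scalerDr !scalerA => /lattice_basis_inj[_ ->]; exists f.
Qed.

(* The projection onto [V] has coordinates [(p, q)] with [a p + b q = 1] for a
   generator [a u + b v] of the lattice of [V]: so [- q u + p v] generates its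
   kernel, the lattice of [W]. *)
Lemma cyclic_lattice_complement V W : (V + W <= frac_plane u v)%VS ->
  (V :&: W = 0)%VS -> V != 0%VS ->
  (forall x, to_frac x \in frac_plane u v -> exists y z,
     [/\ to_frac y \in V, to_frac z \in W & x = y + z]) ->
  cyclic_lattice V -> cyclic_lattice W.
Proof.
rewrite subv_add => /andP[VP WP] VW0 Vn0 split_plane [y yV yP].
have yn0 : y != 0.
  have [x xn0 /yP[c xy]] := nonzero_lattice_vector Vn0.
  by apply: contraNneq xn0 => y0; rewrite xy y0 scaler0.
have coef0 := disjoint_lattice_coef0 VW0 yn0 yV.
have [a [b yE]] := uv_span (subvP VP _ yV).
have [_ [u' [/yP[p ->] u'W uE]]] := split_plane u (memv_lineDl _ _).
have [_ [v' [/yP[q ->] v'W vE]]] := split_plane v (memv_lineDr _ _).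
have comb s t : s *: u + t *: v = (s * p + t * q) *: y + (s *: u' + t *: v').
  by rewrite {1}uE {1}vE !scalerDr !scalerA addrACA -scalerDl.
have W' s t : to_frac (s *: u' + t *: v') \in W.
  by rewrite raddfD /= !to_fracZ memvD // memvZ.
have ab1 : a * p + b * q = 1.
  apply/eqP; rewrite -subr_eq0; apply/eqP/(coef0 (a *: u' + b *: v')) => //.
  by rewrite scalerBl scale1r addrAC -comb -yE subrr.
exists (- q *: u + p *: v).
  by rewrite comb (_ : - q * p + p * q = 0) ?scale0r ?add0r //; ring.
move=> x xW; have [c [d xE]] := uv_span (subvP WP _ xW).
have cd0 : c * p + d * q = 0.
  apply: (coef0 (c *: u' + d *: v' - x)); first by rewrite raddfB /= memvB.
  by rewrite addrA -comb -xE subrr.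
exists (a * d - b * c); rewrite xE scalerDr !scalerA.
by have [cE dE] := unimodular_kernel ab1 cd0; congr (_ *: _ + _ *: _).
Qed.

End LatticeBasis.

End FractionLattice.

Section SymplecticLattice.
Variables (R : idomainType) (n : nat) (w : {biscalar 'rV[R]_(2 * n)}).
Hypothesis w_symplectic : symplectic_form w.

Lemma gram_alternating x : gram_form (gram w) x x = 0.
Proof.
have [d dn0 [y e]] := clear_denominators x.
have := gram_formE w y y; rewrite w_symplectic.1 -e linearZl_LR linearZr_LR /=.
by rewrite rmorph0 => /eqP; rewrite !mulf_eq0 tofrac_eq0 (negPf dn0) => /eqP.
Qed.

Lemma gram_unit : gram w \in unitmx.
Proof.
rewrite -row_free_unit; apply: inj_row_free => x xG.
have [d dn0 [y e]] := clear_denominators x.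
have y0 : y = 0.
  apply: w_symplectic.2 => z; apply/eqP; rewrite -tofrac_eq0 -gram_formE.
  by rewrite -e /gram_form -scalemxAl xG scaler0 mul0mx mxE.
move/eqP: e; rewrite y0 raddf0 scaler_eq0 tofrac_eq0 (negPf dn0).
by move/eqP.
Qed.

Lemma exists_isotropic_lattice_basis : dedekind_domain R -> (0 < n)%N ->
  exists u v, lattice_basis u v /\ ((1 < n)%N -> w u v = 0).
Proof.
move=> dR n0; pose e i : 'rV[R]_(2 * n) := delta_mx 0 i.
have [i0_lt i1_lt] : (0 < 2 * n /\ 1 < 2 * n)%N by lia.
pose i0 := Ordinal i0_lt; pose i1 := Ordinal i1_lt.
have [n1|n1] := leqP n 1.
  exists (e i0), (e i1); split=> //.
  apply: lattice_basis_delta; last by rewrite mxE.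
  exists (delta_mx i1 0); rewrite mul_delta_mx.
  by apply/matrixP => i j; rewrite !mxE !ord1.
have [i2_lt i3_lt] : (2 < 2 * n /\ 3 < 2 * n)%N by lia.
pose i2 := Ordinal i2_lt; pose i3 := Ordinal i3_lt.
have [x [y [z [orth [a [b [c abc]]]]]]] := orthogonal_unimodular dR
  (w (e i0) (e i1)) (w (e i0) (e i2)) (w (e i0) (e i3)).
exists (e i0), (x *: e i1 + y *: e i2 + z *: e i3).
split; last by move=> _; rewrite !linearDr !linearZr_LR -[RHS]orth.
apply: lattice_basis_delta; last by rewrite !mxE !mulr0 !addr0.
exists (a *: delta_mx i1 0 + b *: delta_mx i2 0 + c *: delta_mx i3 0).
apply/matrixP => i j; rewrite !ord1 !mulmxDr -!scalemxAr -!colE !mxE /=.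
by rewrite -[RHS]abc !(mulr0, mulr1, addr0, add0r).
Qed.

Lemma integral_frame_split (L : frame n (gram w)) k l x :
  integral_frame L -> k != l -> to_frac x \in (L k + L l)%VS ->
  exists y z, [/\ to_frac y \in L k, to_frac z \in L l & x = y + z].
Proof.
move=> intL kl xkl; have [y [[yL xE] _]] := intL x.
exists (y k), (y l); split=> //.
rewrite xE (bigD1 k) //= (bigD1 l) 1?eq_sym //=.
rewrite [X in _ + (_ + X)]big1 ?addr0 //.
move=> j /andP[jk jl]; apply: to_frac_inj; rewrite raddf0.
apply: (frame_component gram_alternating (L := L) (y := fun j => to_frac (y j))
  (S := pred2 k l)) => //; last by rewrite /= negb_or jk.
rewrite -raddf_sum -xE (bigD1 k) /= ?eqxx //.
rewrite (bigD1 l) /= ?eqxx ?orbT 1?eq_sym //.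
by rewrite big1 ?addv0 // => i; case: (i == k); case: (i == l).
Qed.

Lemma integral_frame_cyclic_lattice (L : frame n (gram w)) k l u v :
  integral_frame L -> lattice_basis u v -> k != l ->
  (L k + L l = frac_plane u v)%VS ->
  cyclic_lattice (L k) -> cyclic_lattice (L l).
Proof.
move=> intL uv kl LE; apply: (cyclic_lattice_complement uv); rewrite ?LE //.
- exact: (frame_line_disjoint gram_alternating).
- by rewrite -dimv_eq0 frame_dim.
by move=> x; rewrite -LE; exact: integral_frame_split.
Qed.

End SymplecticLattice.

(** * Counting flags *)

Section SignedSums.
Variable n : nat.

Lemma sgen_neq (i : 'I_n) : sgen i (i, false) != (i, false).
Proof.
rewrite /sgen; case: insubP => [j _ /= ji|_]; last first.
  by rewrite sflipE eqxx xpair_eqE andbF.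
rewrite sswapE tpermL xpair_eqE eqxx andbT.
by apply/eqP => ij; rewrite ij in ji; lia.
Qed.

Lemma signed_sum_eq0 (i : 'I_n) (f : signed_perm n -> int) :
  (forall s, f (sgen_mul i s) = f s) ->
  \sum_s (-1) ^+ slength (val s) * f s = 0.
Proof.
move=> f_inv; set S := \sum_s _; suff : S = - S by lia.
rewrite {1}/S (reindex_inj (can_inj (sgen_mulK i))) /= /S -sumrN.
apply: eq_bigr => s _; rewrite f_inv -mulNr; congr (_ * _).
rewrite -[LHS]signr_odd -[in RHS]signr_odd.
rewrite (odd_slength_mul (mem_sgen i) (valP s)).
by case: (odd _); rewrite /= ?expr0 ?expr1 ?opprK.
Qed.

Lemma is_signed1 : is_signed (1%g : {perm signed_index n}).
Proof. by apply/signedP => k; rewrite !perm1. Qed.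

Definition signed_id : signed_perm n := exist _ 1%g is_signed1.

Lemma signed_perm_eq (s t : signed_perm n) :
  (forall i, val s (i, false) = val t (i, false)) -> s = t.
Proof.
move=> st; apply/val_inj/permP => -[i []] //.
by rewrite -[(i, true)]/(sneg (i, false)) !signedE st.
Qed.

End SignedSums.

Section TopDegree.
Variables (d : Order.disp_t) (P : porderType d) (p : nat).

HB.instance Definition _ := GRing.isZmodMorphism.Build (cycles P p)
  (reduced_homology P p) (@homology_class d P p)
  (raddfB \pi_({ideal_quot (@is_boundary d P p)})%qT).

Lemma homology_class_inj : (simplex P p.+1 -> False) ->
  injective (@homology_class d P p).
Proof.
move=> no_simplex; apply: raddf_inj => z /eqP.
rewrite -[X in _ == X](raddf0 (@homology_class d P p)) -Quotient.idealrBE subr0.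
case/asboolP => b; have -> : b = 0.
  by apply/eqP/freeg_eqP => s; case: (no_simplex s).
by rewrite raddf0 => z0; apply: val_inj; rewrite -z0.
Qed.

Lemma homology_class_sum_inj (I : finType) (c : I -> int)
    (z : I -> cycles P p) z0 : (simplex P p.+1 -> False) ->
  homology_class z0 = \sum_i homology_class (z i) *~ c i ->
  val z0 = \sum_i val (z i) *~ c i.
Proof.
move=> no_simplex z0E; have -> : z0 = \sum_i z i *~ c i.
  apply: (homology_class_inj no_simplex); rewrite z0E raddf_sum.
  by apply: eq_bigr => i _; rewrite raddfMz.
by rewrite raddf_sum; apply: eq_bigr => i _; rewrite raddfMz.
Qed.

End TopDegree.

Section IsotropicSimplices.
Variables (K : fieldType) (m : nat) (G : 'M[K]_m).

Lemma sorted_isotropic_dim (s : seq (isotropic_poset G)) x0 i :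
  sorted <%O s -> (i < size s)%N -> (i < \dim (val (nth x0 s i)))%N.
Proof.
move=> s_sorted; elim: i => [|i IH] i_lt.
  by rewrite lt0n dimv_eq0; case: (nth x0 s 0) => V /= /andP[].
apply: leq_ltn_trans (IH (ltnW i_lt)) _.
have : (nth x0 s i < nth x0 s i.+1)%O.
  by rewrite (sorted_ltn_nth lt_trans) ?inE // ltnW.
rewrite lt_neqAle => /andP[ne le]; rewrite ltnNge; apply: contra ne => dim_le.
by apply/eqP/val_inj/eqP; rewrite eqEdim dim_le andbT; exact: le.
Qed.

Lemma isotropic_simplex_size p : G \in unitmx ->
  simplex (isotropic_poset G) p -> (2 * p <= m)%N.
Proof.
move=> G_unit [s /andP[s_sorted /eqP size_s]]; case: p size_s => // p size_s.
case: s => // V s in s_sorted size_s *.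
have := @sorted_isotropic_dim _ V p s_sorted; rewrite size_s => /(_ (leqnn _)).
case: (nth V _ p) => W /= /andP[_ /asboolP/(isotropic_dim G_unit)].
by move: (\dim W) => d; lia.
Qed.

End IsotropicSimplices.

Section FrameFlags.
Variables (K : fieldType) (n m : nat) (G : 'M[K]_m).
Implicit Types (L : frame n G) (s t : signed_perm n).

Definition flag_space (s : simplex (isotropic_poset G) n) (j : nat) :
    {vspace 'rV[K]_m} := nth 0%VS [seq val V | V <- val s] j.

Lemma flag_space_frame L s (j : 'I_n) :
  flag_space (frame_simplex L s) j = frame_flag L (val s) j.+1.
Proof.
by rewrite /flag_space -map_comp (nth_map j) ?size_enum_ord // nth_ord_enum.
Qed.

Hypothesis G_alt : forall x, gram_form G x x = 0.

Lemma frame_line_sub_flag L (t : {perm signed_index n}) k j :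
  (L k <= frame_flag L t j)%VS ->
  exists2 i : 'I_n, (i < j)%N & k = t (i, false).
Proof.
move=> kt; have /existsP[i /andP[ij /eqP kE]] :
    [exists i : 'I_n, (i < j)%N && (k == t (i, false))]; last by exists i.
apply: (frame_line_sub G_alt (L := L)
  (S := fun l => [exists i : 'I_n, (i < j)%N && (l == t (i, false))])).
apply: subv_trans kt _; apply/subv_sumP => i ij.
apply: (sumv_sup (t (i, false))) => //.
by apply/existsP; exists i; rewrite ij eqxx.
Qed.

Lemma frame_flag_inj L s t :
  (forall j : 'I_n, frame_flag L (val s) j.+1 = frame_flag L (val t) j.+1) ->
  s = t.
Proof.
move=> st; apply: signed_perm_eq => j.
have [d] := ubnP j; elim: d j => // d IH j jd.
have [|i ij sj] := @frame_line_sub_flag L (val t) (val s (j, false)) j.+1.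
  by rewrite -st; apply: (sumv_sup j).
move: ij; rewrite ltnS leq_eqVlt => /orP[/eqP/val_inj ij|ij].
  by rewrite sj ij.
have si : val s (i, false) = val t (i, false) by apply: IH; lia.
by have /perm_inj[ji] := etrans sj (esym si); rewrite ji ltnn in ij.
Qed.

End FrameFlags.

Section PanelPlane.
Variables (K : fieldType) (n : nat) (G : 'M[K]_(2 * n.+1)).
Hypothesis G_alt : forall x, gram_form G x x = 0.
Implicit Types (L : frame n.+1 G) (s : {perm signed_index n.+1}).

Let k0 : signed_index n.+1 := (ord0, false).

(* The chambers [s] and [sgen ord0 * s] of the apartment share the panel
   [L_{s([2])} < ... < L_{s([n + 1])}] and only differ in their first vertex. *)
Definition panel_plane L s : {vspace 'rV[K]_(2 * n.+1)} :=
  (L (s k0) + L ((sgen ord0 * s)%g k0))%VS.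

Lemma frame_flag1 L s : frame_flag L s 1 = L (s k0).
Proof.
by rewrite /frame_flag (big_pred1 ord0) // => i; rewrite /= ltnS leqn0.
Qed.

Lemma panel_planeE L s : (0 < n)%N -> panel_plane L s = frame_flag L s 2.
Proof.
move=> n_gt0; rewrite /panel_plane permM /sgen.
case: insubP => [j _ /= j1|]; last by rewrite ltnS n_gt0.
rewrite sswapE tpermL /frame_flag (bigD1 ord0) //= (bigD1 j) /=.
  by rewrite big1 ?addv0 // => i; rewrite -!val_eqE /= j1; lia.
by rewrite -val_eqE /= j1.
Qed.

Lemma dim_panel_plane L s : \dim (panel_plane L s) = 2%N.
Proof.
rewrite /panel_plane dimv_disjoint_sum ?frame_dim //.
apply: (frame_line_disjoint G_alt); rewrite permM (inj_eq perm_inj) eq_sym.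
exact: sgen_neq.
Qed.

Lemma panel_plane_full L s : n = 0%N -> panel_plane L s = fullv.
Proof.
move=> n0; apply/eqP; rewrite eqEdim subvf dimvf dim_panel_plane /dim /=; lia.
Qed.

Lemma panel_plane_eq L L' s s' :
  (forall j : 'I_n.+1, (0 < j)%N ->
     frame_flag L s j.+1 = frame_flag L' s' j.+1) ->
  panel_plane L s = panel_plane L' s'.
Proof.
have [n0|n_gt0 flags] := posnP n; first by rewrite !panel_plane_full.
rewrite !panel_planeE //.
by rewrite (flags (Ordinal (n_gt0 : (1 < n.+1)%N))).
Qed.

Lemma frame_line_sub_panel_plane L s k :
  (L k <= panel_plane L s)%VS -> (k == s k0) || (k == (sgen ord0 * s)%g k0).
Proof.
move=> kp; apply: (frame_line_sub G_alt (L := L)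
  (S := pred2 (s k0) ((sgen ord0 * s)%g k0))).
apply: subv_trans kp _; rewrite subv_add.
by apply/andP; split; [apply: (sumv_sup (s k0))
  |apply: (sumv_sup ((sgen ord0 * s)%g k0))]; rewrite //= eqxx ?orbT.
Qed.

Lemma exists_panel_frame x y : G \in unitmx -> x != 0 -> y \notin <[x]>%VS ->
  ((0 < n)%N -> gram_form G x y = 0) ->
  exists L : frame n.+1 G, L k0 = <[x]>%VS /\ L (sgen ord0 k0) = <[y]>%VS.
Proof.
move=> G_unit xn0 yx xy; rewrite /sgen; case: insubP => [j j_lt /= j1|n0].
  rewrite sswapE tpermL; apply: isotropic_pair_frame => //; last exact: xy.
  by rewrite -val_eqE /= j1.
rewrite sflipE eqxx; apply: hyperbolic_pair_frame => //.
apply: contra n0 => /eqP /(isotropic_lines G_alt)/(isotropic_dim G_unit).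
by rewrite leq_pmul2l // => dim_le; exact: leq_trans (dim_addv_line xn0 yx) _.
Qed.

End PanelPlane.

Section FlagCount.
Variables (K : fieldType) (n : nat) (G : 'M[K]_(2 * n.+1)).
Hypotheses (G_unit : G \in unitmx) (G_alt : forall x, gram_form G x x = 0).

Let k0 : signed_index n.+1 := (ord0, false).
Let l0 : signed_index n.+1 := sgen ord0 k0.

Implicit Types (L : frame n.+1 G) (s : signed_perm n.+1).
Variables (L0 : frame n.+1 G) (P : {vspace 'rV[K]_(2 * n.+1)} -> Prop).

Definition counted_flag (f : simplex (isotropic_poset G) n.+1) : Prop :=
  P (flag_space f 0) /\
  forall j : 'I_n.+1, (0 < j)%N -> flag_space f j = frame_flag L0 1%g j.+1.

Definition flag_count : chain (isotropic_poset G) n.+1 -> int^o :=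
  fglift (fun f => (`[< counted_flag f >])%:R : int^o).

HB.instance Definition _ := GRing.isZmodMorphism.Build
  (chain (isotropic_poset G) n.+1) int^o flag_count (lift_is_additive _).

Lemma flag_count_apartment L : flag_count (apartment_chain L) =
  \sum_s (-1) ^+ slength (val s) * (`[< counted_flag (frame_simplex L s) >])%:R.
Proof.
rewrite /apartment_chain raddf_sum; apply: eq_bigr => s _ /=.
have -> : (-1) ^+ slength (val s) *: << frame_simplex L s >> =
    << (-1) ^+ slength (val s) *g frame_simplex L s >>
       :> {freeg (simplex (isotropic_poset G) n.+1)}.
  by apply/eqP/freeg_eqP => x; rewrite coeffZ !coeffU mul1r.
by rewrite /flag_count liftU.
Qed.

Lemma counted_flag_frame L s : counted_flag (frame_simplex L s) <->
  P (L (val s k0)) /\ forall j : 'I_n.+1, (0 < j)%N ->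
    frame_flag L (val s) j.+1 = frame_flag L0 1%g j.+1.
Proof.
rewrite /counted_flag (flag_space_frame L s ord0) frame_flag1.
by split=> -[? flags]; split=> // j /flags; rewrite flag_space_frame.
Qed.

Lemma flag_count_eq0 L :
  (forall k l, k != l -> (L k + L l = panel_plane L0 1)%VS ->
     P (L k) -> P (L l)) ->
  flag_count (apartment_chain L) = 0.
Proof.
move=> swapP; rewrite flag_count_apartment.
have swap s : counted_flag (frame_simplex L s) ->
    counted_flag (frame_simplex L (sgen_mul ord0 s)).
  move=> /counted_flag_frame[Ps flags]; apply/counted_flag_frame.
  split; last first.
    move=> j j_gt0; rewrite -flags //; apply: frame_flag_sgen.
    by rewrite -val_eqE /= -lt0n.
  apply: swapP Ps; last exact: panel_plane_eq.
  by rewrite permM (inj_eq perm_inj) eq_sym sgen_neq.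
apply: signed_sum_eq0 (ord0 : 'I_n.+1) _ _ => s.
congr (nat_of_bool _)%:R; apply: asbool_equiv_eq; split; last exact: swap.
by move/swap; rewrite sgen_mulK.
Qed.

Hypotheses (Pk0 : P (L0 k0)) (nPl0 : ~ P (L0 l0)).

Lemma counted_flag_base s :
  counted_flag (frame_simplex L0 s) <-> s = signed_id _.
Proof.
rewrite counted_flag_frame.
split=> [[Ps flags]|->]; last by split; rewrite //= perm1.
have s_k0 : val s k0 = k0.
  have : (L0 (val s k0) <= panel_plane L0 1)%VS.
    by rewrite -(panel_plane_eq G_alt flags) addvSl.
  move=> /(frame_line_sub_panel_plane G_alt); rewrite mulg1 perm1.
  by case/orP => /eqP // sl0; case: nPl0; rewrite /l0 -sl0.
apply: (frame_flag_inj G_alt (L := L0)) => j.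
have [j0|] := posnP j; last exact: flags.
by rewrite j0 !frame_flag1 s_k0 perm1.
Qed.

Lemma flag_count_neq0 : flag_count (apartment_chain L0) != 0.
Proof.
rewrite flag_count_apartment (bigD1 (signed_id _)) //=.
rewrite big1 ?addr0 => [|s s_neq1].
  rewrite mulf_neq0 ?signr_eq0 //.
  suff /asboolP -> : counted_flag (frame_simplex L0 (signed_id _)) by [].
  exact/counted_flag_base.
rewrite [`[< _ >]]asboolF ?mulr0 // => /counted_flag_base s1.
by rewrite s1 eqxx in s_neq1.
Qed.

Lemma apartment_class_notin_span (I : finType) (c : I -> int)
    (L : I -> frame n.+1 G) :
  (forall i k l, k != l -> (L i k + L i l = panel_plane L0 1)%VS ->
     P (L i k) -> P (L i l)) ->
  apartment_class L0 <> \sum_i apartment_class (L i) *~ c i.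
Proof.
move=> swapP e; have no_simplex : simplex (isotropic_poset G) n.+2 -> False.
  by move=> /(isotropic_simplex_size G_unit); lia.
have /(congr1 flag_count) count_e := homology_class_sum_inj no_simplex e.
move: flag_count_neq0; rewrite [flag_count _]count_e raddf_sum.
rewrite big1 ?eqxx // => i _; rewrite raddfMz /= flag_count_eq0 ?mul0rz //.
exact: swapP.
Qed.

End FlagCount.

Lemma exists_half_cyclic_frame (R : idomainType) (h n : nat)
    (w : {biscalar 'rV[R]_(2 * n.+1)}) :
  dedekind_domain R -> class_number R h -> (2 <= h)%N -> symplectic_form w ->
  exists u v (L : frame n.+1 (gram w)),
    [/\ lattice_basis u v, panel_plane L 1 = frac_plane u v,
        cyclic_lattice (L (ord0, false))
      & ~ cyclic_lattice (L (sgen ord0 (ord0, false)))].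
Proof.
move=> R_dedekind class_number_R h_ge2 w_symplectic.
have [G_alt G_unit] := (gram_alternating w_symplectic, gram_unit w_symplectic).
have [u [v [uv wuv]]] := exists_isotropic_lattice_basis w R_dedekind isT.
have [a [b [bn0 nonprincipal]]] :=
  exists_nonprincipal_colon R_dedekind class_number_R h_ge2.
have v'_notin := lattice_basis_notin_line uv a bn0.
have [||L [Lk Ll]] := exists_panel_frame G_alt G_unit _ v'_notin.
- rewrite -(raddf0 (@to_frac R _)) (inj_eq (@to_frac_inj _ _)).
  exact: lattice_basis_neq0 uv.
- move=> n_gt0; rewrite gram_formE linearDr !linearZr_LR /= wuv //.
  by rewrite w_symplectic.1 !mulr0 addr0 rmorph0.
exists u, v, L; split=> //.
- by rewrite /panel_plane mulg1 !perm1 Lk Ll; exact: frac_plane_shear.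
- by rewrite Lk; exact: cyclic_lattice_line uv.
by rewrite Ll => /(colon_principal_of_cyclic_lattice uv bn0).
Qed.

Theorem theorem1p2 (R : idomainType) (h n : nat)
    (w : {biscalar 'rV[R]_(2 * n)})
    (R_dedekind : dedekind_domain R)
    (class_number_R : class_number R h) (h_ge2 : (2 <= h)%N)
    (n_ge1 : (1 <= n)%N)
    (w_symplectic : symplectic_form w) :
  ~ generated_by (@integral_apartment_class R n w).
Proof.
case: n w n_ge1 w_symplectic => // n w _ w_symplectic generated.
have [G_alt G_unit] := (gram_alternating w_symplectic, gram_unit w_symplectic).
have [u [v [L0 [uv planeE cyclic_k0 noncyclic_l0]]]] :=
  exists_half_cyclic_frame R_dedekind class_number_R h_ge2 w_symplectic.
have [p [c [g [g_integral classE]]]] := generated (apartment_class L0).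
have /choice[L LP] i : exists L, integral_frame L /\ g i = apartment_class L.
  by have [L] := g_integral i; exists L.
apply: (apartment_class_notin_span G_unit G_alt cyclic_k0 noncyclic_l0
  (c := c) (L := L)) => [i k l kl|].
  rewrite planeE; have [L_integral _] := LP i.
  exact: integral_frame_cyclic_lattice.
by rewrite classE; apply: eq_bigr => i _; have [_ ->] := LP i.
Qed.
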